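(* Let $G$ be a Fitting-regular profinite group. Then $C_G(F^*(G)) = Z(F(G))$.
   Context: Profinite groups are regarded as topological groups: subgroups are required to be closed, homomorphisms continuous, and generation means topological generation. For a profinite group $G$ and a prime $p$, $O_p(G)$ is the subgroup generated by all normal pro-$p$ subgroups of $G$; the Fitting subgroup $F(G)$ is the subgroup generated by the $O_p(G)$ for all primes $p$. A profinite group $Q$ is quasisimple if $Q$ is perfect and $Q/Z(Q)$ is simple. A component of $G$ is a subnormal quasisimple subgroup of $G$; the layer $E(G)$ is the subgroup generated by all components of $G$. The generalised Fitting subgroup $F^*(G)$ is the subgroup generated by $F(G)$ and $E(G)$. $G$ is Fitting-degenerate if $F^*(G)$ is trivial. $G$ is Fitting-regular if no non-trivial image (quotient by a closed normal subgroup) of $G$ is Fitting-degenerate. *)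

(* Defs.v *)
From HB Require Import structures.
From mathcomp Require Import all_boot.
From mathcomp Require Import all_classical topology.

Set Implicit Arguments.
Unset Strict Implicit.
Unset Printing Implicit Defensive.

Local Open Scope classical_set_scope.
Local Open Scope group_scope.
Local Open Scope quotient_scope.

HB.mixin Record isTopGroup G of Group G & Topological G := {
  mulg_continuous : continuous (fun xy : G * G => xy.1 * xy.2);
  invg_continuous : continuous (fun x : G => x^-1)
}.

#[short(type="topGroupType")]
HB.structure Definition TopGroup :=
  {G of isTopGroup G & Group G & Topological G}.

Definition profinite (G : topGroupType) : Prop :=
  [/\ compact [set: G], hausdorff_space G & totally_disconnected [set: G]].

(* Abstract subgroups: closedness is a separate hypothesis, added wherever a
   subgroup of a profinite group is meant. *)
Record subgroup (G : groupType) := Subgroup {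
  subgroup_set :> set G;
  subgroup1 : subgroup_set 1;
  subgroupF : forall x y, subgroup_set x -> subgroup_set y ->
    subgroup_set (x / y)
}.

(* closed under conjugation by the elements of H *)
Definition normalised_by (G : groupType) (H N : set G) : Prop :=
  forall x y, N x -> H y -> N (x ^ y).

Record normal_subgroup (G : groupType) := NormalSubgroup {
  normal_val :> subgroup G;
  normalJ : normalised_by [set: G] normal_val
}.

Section SubgroupLemmas.
Context (G : groupType) (H : subgroup G).
Local Notation S := (subgroup_set H).

Lemma subgroupV x : S x -> S x^-1.
Proof.
by move=> Hx; rewrite -[x^-1]mul1g; apply: subgroupF => //; exact: subgroup1.
Qed.

Lemma subgroupM x y : S x -> S y -> S (x * y).
Proof.
by move=> Hx Hy; rewrite -[y]invgK; apply: subgroupF => //; exact: subgroupV.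
Qed.

End SubgroupLemmas.

(* H as a topological group in its own right, with the subspace topology *)
Definition subgroup_type (G : groupType) (H : subgroup G) : Type := set_type H.

Section SubgroupGroup.
Context (G : groupType) (H : subgroup G).

HB.instance Definition _ := SubChoice.copy (subgroup_type H) (set_type H).

Fact subgroup_group_closed : group_closed (mem (subgroup_set H)).
Proof.
split; first by apply/mem_set; exact: subgroup1.
by move=> x y /set_mem Hx /set_mem Hy; apply/mem_set; exact: subgroupF.
Qed.

HB.instance Definition _ :=
  SubChoice_isSubGroup.Build G _ (subgroup_type H)
    subgroup_group_closed.
End SubgroupGroup.

Section SubgroupTopology.
Context (G : topGroupType) (H : subgroup G).
HB.instance Definition _ := Topological.copy (subgroup_type H) (set_type H).

Let val_cont : continuous (val : subgroup_type H -> G).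
Proof. exact: (@initial_continuous _ _ (set_val : set_type H -> G)). Qed.

Fact subgroup_mulg_continuous :
  continuous (fun xy : subgroup_type H * subgroup_type H => xy.1 * xy.2).
Proof.
apply: (@continuous_comp_initial _ _ _ (set_val : set_type H -> G)) => -[x y].
apply: (@continuous2_cvg _ _ _ _ _ _ (fun xy => val xy.1)
  (fun xy => val xy.2) mul); first exact: (mulg_continuous (val x, val y)).
  by apply: cvg_comp; [exact: cvg_fst | exact: val_cont].
by apply: cvg_comp; [exact: cvg_snd | exact: val_cont].
Qed.

Fact subgroup_invg_continuous :
  continuous (fun x : subgroup_type H => x^-1).
Proof.
apply: (@continuous_comp_initial _ _ _ (set_val : set_type H -> G)) => x.
change {for x, continuous ((fun y : G => y^-1) \o (val : subgroup_type H -> G))}.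
by apply: continuous_comp; [exact: val_cont | exact: invg_continuous].
Qed.

HB.instance Definition _ := isTopGroup.Build (subgroup_type H)
  subgroup_mulg_continuous subgroup_invg_continuous.

End SubgroupTopology.

Definition coset_rel (G : groupType) (N : subgroup G) (x y : G) : bool :=
  `[< subgroup_set N (x^-1 * y) >].

Section Cosets.
Context (G : groupType) (N : subgroup G).

Fact coset_rel_refl : reflexive (coset_rel N).
Proof. by move=> x; apply/asboolP; rewrite mulVg; exact: subgroup1. Qed.

Fact coset_rel_sym : symmetric (coset_rel N).
Proof.
by move=> x y; apply/asboolP/asboolP => /subgroupV; rewrite invgM invgK.
Qed.

Fact coset_rel_trans : transitive (coset_rel N).
Proof.
move=> y x z /asboolP xy /asboolP yz; apply/asboolP.
by have := subgroupM xy yz; rewrite mulgA mulgK.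
Qed.

Canonical coset_equiv :=
  EquivRel (coset_rel N) coset_rel_refl coset_rel_sym coset_rel_trans.

End Cosets.

Definition quotient_group (G : topGroupType) (N : normal_subgroup G) : Type :=
  quotient_topology {eq_quot coset_equiv N}.

Section QuotientGroup.
Context (G : topGroupType) (N : normal_subgroup G).
Local Notation Q := (quotient_group N).

HB.instance Definition _ := Topological.copy Q
  (quotient_topology {eq_quot coset_equiv N}).
HB.instance Definition _ := Quotient.copy Q {eq_quot coset_equiv N}.

Lemma pi_quotientP (x y : G) :
  \pi_Q x = \pi_Q y <-> subgroup_set N (x^-1 * y).
Proof.
by split=> [/eqmodP/asboolP//|Nxy]; apply/eqmodP/asboolP.
Qed.

Definition quotient_mul (a b : Q) : Q := \pi_Q (repr a * repr b).
Definition quotient_one : Q := \pi_Q 1.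
Definition quotient_inv (a : Q) : Q := \pi_Q (repr a)^-1.

Lemma quotient_mulE (x y : G) : quotient_mul (\pi_Q x) (\pi_Q y) = \pi_Q (x * y).
Proof.
rewrite /quotient_mul; set x' := repr _; set y' := repr _.
have /pi_quotientP xx' : \pi_Q x' = \pi_Q x by rewrite reprK.
have /pi_quotientP yy' : \pi_Q y' = \pi_Q y by rewrite reprK.
apply/pi_quotientP; rewrite invgM.
have -> : y'^-1 * x'^-1 * (x * y) = ((x'^-1 * x) ^ y') * (y'^-1 * y).
  by rewrite /conjg !mulgA mulgK.
by apply: subgroupM => //; apply: normalJ.
Qed.

Lemma quotient_invE (x : G) : quotient_inv (\pi_Q x) = \pi_Q x^-1.
Proof.
rewrite /quotient_inv; set x' := repr _.
have /esym/pi_quotientP xx' : \pi_Q x' = \pi_Q x by rewrite reprK.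
apply/pi_quotientP; rewrite invgK.
have -> : x' * x^-1 = (x^-1 * x') ^ x^-1.
  by rewrite /conjg invgK !mulgA mulgV mul1g.
exact: normalJ.
Qed.

Fact quotient_mulgA : associative quotient_mul.
Proof.
elim/quotW=> x; elim/quotW=> y; elim/quotW=> z.
rewrite (quotient_mulE y z) (quotient_mulE x y).
by rewrite (quotient_mulE x) (quotient_mulE _ z) mulgA.
Qed.

Fact quotient_mul1g : left_id quotient_one quotient_mul.
Proof. by elim/quotW=> x; rewrite quotient_mulE mul1g. Qed.

Fact quotient_mulg1 : right_id quotient_one quotient_mul.
Proof. by elim/quotW=> x; rewrite quotient_mulE mulg1. Qed.

Fact quotient_mulVg : left_inverse quotient_one quotient_inv quotient_mul.
Proof. by elim/quotW=> x; rewrite quotient_invE quotient_mulE mulVg. Qed.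

Fact quotient_mulgV : right_inverse quotient_one quotient_inv quotient_mul.
Proof. by elim/quotW=> x; rewrite quotient_invE quotient_mulE mulgV. Qed.

HB.instance Definition _ := isGroup.Build Q quotient_mulgA quotient_mul1g
  quotient_mulg1 quotient_mulVg quotient_mulgV.

Let pi_cont : continuous (\pi_Q : G -> Q).
Proof. exact: (@pi_continuous G {eq_quot coset_equiv N}). Qed.

Lemma pi_quotient_open (U : set G) : open U -> open (\pi_Q @` U).
Proof.
move=> oU; rewrite /open /= /quotient_open.
rewrite (_ : _ @^-1` _ = \bigcup_(n in subgroup_set N) ((mul^~ n) @^-1` U)).
  apply: bigcup_open => n _; apply: open_comp => // x _.
  apply: (@continuous2_cvg _ _ _ _ _ _ id (cst n) mul).
  - exact: (mulg_continuous (x, n)).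
  - exact: cvg_id.
  - exact: cvg_cst.
apply/seteqP; split=> [x [u Uu /esym/pi_quotientP Nxu]|x [n Nn Uxn]] /=.
  by exists (x^-1 * u) => //=; rewrite mulgA mulgV mul1g.
exists (x * n) => //; apply/esym/pi_quotientP.
by rewrite mulgA mulVg mul1g.
Qed.

Fact quotient_mulg_continuous : continuous (fun ab : Q * Q => ab.1 * ab.2).
Proof.
case=> a b W Wab.
have [W' [oW' W'ab] W'W] : exists2 B : set Q, open_nbhs (a * b) B & B `<=` W.
  by have : nbhs (a * b : Q) W by []; rewrite nbhsE.
have : nbhs (repr a * repr b) (\pi_Q @^-1` W').
  apply: open_nbhs_nbhs; split; last by rewrite /= -quotient_mulE !reprK.
  by apply: open_comp => // x _; exact: pi_cont.
move/(mulg_continuous (repr a, repr b)) => [[U V] /= [nU nV] UVW].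
rewrite nbhsE in nU; rewrite nbhsE in nV.
case: nU nV => U' [oU' U'a] U'U [V' [oV' V'b] V'V].
change (filter_from (fun P => nbhs a P.1 /\ nbhs b P.2)
  (fun P => P.1 `*` P.2) ((fun ab : Q * Q => ab.1 * ab.2) @^-1` W)).
exists (\pi_Q @` U', \pi_Q @` V') => /=.
  split; apply: open_nbhs_nbhs; split; try exact: pi_quotient_open.
    by exists (repr a) => //; rewrite reprK.
  by exists (repr b) => //; rewrite reprK.
move=> [_ _] /= [[x U'x <-] [y V'y <-]]; apply: W'W => /=.
rewrite [_ * _]quotient_mulE.
by apply: (UVW (x, y)); split; [exact: U'U | exact: V'V].
Qed.

Fact quotient_invg_continuous : continuous (fun a : Q => a^-1).
Proof.
apply/(@quotient_continuous G {eq_quot coset_equiv N} Q) => x.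
rewrite (_ : _ \o _ = (\pi_Q : G -> Q) \o (fun y => y^-1)); last first.
  by apply/funext => y /=; exact: quotient_invE.
by apply: continuous_comp; [exact: invg_continuous | exact: pi_cont].
Qed.

HB.instance Definition _ := isTopGroup.Build Q
  quotient_mulg_continuous quotient_invg_continuous.

End QuotientGroup.

(* <A>: the smallest closed subgroup containing A *)
Definition generated (G : topGroupType) (A : set G) : set G :=
  [set x | forall H : subgroup G,
    closed H -> A `<=` H -> subgroup_set H x].

Definition centraliser (G : groupType) (A : set G) : set G :=
  [set x | forall y, A y -> commute x y].

(* Z(A) = C_A(A), for a subgroup A of G *)
Definition center (G : groupType) (A : set G) : set G := A `&` centraliser A.

Section CenterSubgroup.
Context (G : groupType).

Fact center1 : center [set: G] 1.
Proof. by split=> // y _; rewrite /commute mul1g mulg1. Qed.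

Fact centerF (x y : G) :
  center [set: G] x -> center [set: G] y -> center [set: G] (x / y).
Proof.
move=> [_ Cx] [_ Cy]; split=> // z _; rewrite /commute.
have Cyz : y^-1 * z = z * y^-1.
  apply: (mulgI y); rewrite !mulgA mulgV mul1g.
  by rewrite (Cy z I) -mulgA mulgV mulg1.
by rewrite -mulgA Cyz !mulgA (Cx z I).
Qed.

Fact centerJ : normalised_by [set: G] (center [set: G]).
Proof.
move=> x y [_ Cx] _; suff -> : x ^ y = x by [].
by rewrite /conjg (Cx y I) mulgA mulVg mul1g.
Qed.

Definition center_subgroup : normal_subgroup G :=
  @NormalSubgroup G (Subgroup center1 centerF) centerJ.

End CenterSubgroup.

Definition nontrivial (G : groupType) : Prop := exists x : G, x <> 1.

(* simple as a topological group: closed normal subgroups only *)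
Definition simple_group (G : topGroupType) : Prop :=
  nontrivial G /\
  forall N : normal_subgroup G, closed N ->
    N = [set 1] :> set G \/ N = [set: G] :> set G.

Definition perfect (G : topGroupType) : Prop :=
  generated [set z : G | exists x y, z = [~ x, y]] = [set: G].

Definition quasisimple (Q : topGroupType) : Prop :=
  perfect Q /\ simple_group (quotient_group (center_subgroup Q)).

(* every finite continuous quotient of G is a p-group *)
Definition pro_p (p : nat) (G : topGroupType) : Prop :=
  profinite G /\
  forall N : normal_subgroup G, open N ->
    exists k : nat, ([set: quotient_group N] #= `I_(p ^ k))%card.

(* Q = c 0 <| c 1 <| ... <| c n = G, with all c i closed *)
Definition subnormal (G : topGroupType) (Q : subgroup G) : Prop :=
  exists (n : nat) (c : nat -> subgroup G),
    [/\ c 0%N = Q :> set G, c n = [set: G] :> set G &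
        forall i, (i < n)%N ->
          [/\ closed (c i), c i `<=` c i.+1 & normalised_by (c i.+1) (c i)]].

Definition component (G : topGroupType) (Q : subgroup G) : Prop :=
  [/\ closed Q, subnormal Q & quasisimple (subgroup_type Q)].

(* O_p(G) *)
Definition p_core (p : nat) (G : topGroupType) : set G :=
  generated [set x | exists N : normal_subgroup G,
    [/\ closed N, pro_p p (subgroup_type N) & subgroup_set N x]].
Arguments p_core p G : clear implicits.

(* F(G) *)
Definition Fitting (G : topGroupType) : set G :=
  generated [set x | exists p : nat, prime p /\ p_core p G x].
Arguments Fitting G : clear implicits.

(* E(G) *)
Definition layer (G : topGroupType) : set G :=
  generated [set x | exists Q : subgroup G, component Q /\ subgroup_set Q x].
Arguments layer G : clear implicits.

(* F^*(G) *)
Definition generalised_Fitting (G : topGroupType) : set G :=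
  generated (Fitting G `|` layer G).
Arguments generalised_Fitting G : clear implicits.

Definition Fitting_degenerate (G : topGroupType) : Prop :=
  generalised_Fitting G = [set 1].

Definition Fitting_regular (G : topGroupType) : Prop :=
  forall N : normal_subgroup G, closed N ->
    nontrivial (quotient_group N) -> ~ Fitting_degenerate (quotient_group N).

(* Main.v *)
(* Let C = C_G(F^*(G)) and Z = C n F(G), which is central in C, and let K be
   the preimage of C_{G/Z}(C/Z).  A closed normal subgroup of G whose images in
   finite quotients are nilpotent lies in F(G), being generated by its Sylow
   subgroups; hence K n C, of class at most 2, equals Z.  It follows that G/K is
   Fitting-degenerate.  Indeed, if N/K is normal and pro-p, then N n C is an
   extension of a pro-p group by its central subgroup Z, hence pronilpotent and
   contained in Z, so that [N,C] <= Z and N = K.  If L is a component of G/K,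
   then by the three subgroup lemma L either commutes with the normal subgroup
   CK/K, whose centraliser in G/K is trivial, or lies in it; in the second case
   the derived subgroup of the preimage of L in C is a component of G contained
   in C, hence abelian, a contradiction.  By Fitting-regularity G/K is trivial,
   so C = K n C = Z. *)
From HB Require Import structures.
From mathcomp Require Import all_boot all_fingroup all_solvable.
Require Import Defs.
From mathcomp Require Import all_boot all_classical topology.

Set Implicit Arguments.
Unset Strict Implicit.
Unset Printing Implicit Defensive.

Local Open Scope classical_set_scope.
Local Open Scope group_scope.
Local Open Scope quotient_scope.

(** * Open normal subgroups of profinite groups *)

(** If every clopen set around [x] met [C], the traces on [C] would generate a proper filter; a
    cluster point [y] in [C] contradicts the clopen set separating [x] from [y]. *)
Lemma clopen_avoiding_closed (T : topologicalType) (x : T) (C : set T) :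
  compact [set: T] -> closed C ->
  (forall y, C y -> exists D, [/\ clopen D, D x & ~ D y]) ->
  exists D, [/\ clopen D, D x & D `&` C = set0].
Proof.
move=> cT cC sepC; apply: contrapT => noD.
pose F := filter_from [set D : set T | clopen D /\ D x] (fun D => D `&` C).
have FF : ProperFilter F.
  apply: filter_from_proper.
    apply: filter_from_filter; first by exists setT; split=> //; exact: clopenT.
    move=> A B [cA Ax] [cB Bx]; exists (A `&` B).
      by split; [exact: clopenI | split].
    by move=> y [[Ay By] Cy].
  move=> D [cD Dx]; apply/set0P; apply/eqP => D0.
  by apply: noD; exists D; split.
have [|y [Cy Fy]] := @subclosed_compact _ C setT cC cT (@subsetT _ _) F FF.
  by exists setT; [split=> //; exact: clopenT | move=> y []].
have [D [cD Dx nDy]] := sepC y Cy.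
have FD : F (D `&` C) by exists D.
have nD : nbhs y (~` D).
  by apply: open_nbhs_nbhs; split=> //; apply: closed_openC; case: cD.
by have [z [[Dz _] /(_ Dz)]] := Fy _ _ FD nD.
Qed.

Definition quasi_component (T : topologicalType) (x : T) : set T :=
  [set y | forall D, clopen D -> D x -> D y].

Lemma closed_quasi_component (T : topologicalType) (x : T) :
  closed (quasi_component x).
Proof.
rewrite [quasi_component x](_ : _ =
  \bigcap_(D in [set D : set T | clopen D /\ D x]) D).
  by apply: closed_bigI => D [[]].
by apply/seteqP; split=> y Qy D; [case; exact: Qy | move=> cD Dx; exact: Qy].
Qed.

(** By normality some open [U] contains [A] and has closure disjoint from [B]. The boundary of [U]
    misses the quasi-component, so some clopen [D] around [x] misses that boundary; then [D] meets
    [U] in a clopen set containing the quasi-component. *)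
Lemma quasi_component_split (T : topologicalType) (x : T) (A B : set T) :
  hausdorff_space T -> compact [set: T] -> closed A -> closed B ->
  quasi_component x `<=` A `|` B -> A `&` B = set0 -> A x ->
  quasi_component x `&` B = set0.
Proof.
move=> hT cT cA cB QAB AB0 Ax.
have : filter_from (set_nbhs A) closure (~` B).
  have nAB : set_nbhs A (~` B).
    apply/set_nbhsP; exists (~` B); split=> //; first exact: closed_openC.
    by move=> y Ay By; have : (A `&` B) y by []; rewrite AB0.
  by exact: (compact_normal hT cT cA nAB).
case=> V /set_nbhsP[U [oU AU UV]] VB.
have UB : closure U `<=` ~` B by apply: subset_trans VB; exact: closureS.
have [||D [cD Dx DC]] := @clopen_avoiding_closed T x (closure U `&` ~` U) cT.
- by apply: closedI; [exact: closed_closure | exact: open_closedC].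
- move=> y [cUy nUy].
  have /existsNP[D /not_implyP[cD /not_implyP[Dx nDy]]] :
      ~ quasi_component x y.
    by move=> /QAB[/AU //|By]; exact: UB By.
  by exists D.
have DU : D `&` U = D `&` closure U.
  apply/seteqP; split=> y [Dy Uy]; split=> //; first exact: subset_closure.
  apply: contrapT => nUy.
  by have : (D `&` (closure U `&` ~` U)) y by []; rewrite DC.
apply/seteqP; split=> y // [Qy By].
have [_ Uy] : (D `&` U) y.
  apply: Qy; last by split=> //; exact: AU.
  split; first by apply: openI => //; case: cD.
  by rewrite DU; apply: closedI; [case: cD | exact: closed_closure].
by apply: UB By; exact: subset_closure.
Qed.

(** The quasi-component of [x] is connected, hence reduced to [x], so a clopen set separates [x]
    from any other point. *)
Lemma totally_disconnected_zero_dimensional (T : topologicalType) :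
  compact [set: T] -> hausdorff_space T -> totally_disconnected [set: T] ->
  zero_dimensional T.
Proof.
move=> cT hT dT x y xy.
have [Qy|] := pselect (quasi_component x y); last first.
  by move=> /existsNP[D /not_implyP[cD /not_implyP[Dx nDy]]]; exists D.
have Qx : quasi_component x x by [].
suff cQ : connected (quasi_component x).
  have := connected_component_max Qx (@subsetT _ _) cQ.
  by rewrite dT // => /(_ y Qy) yx; rewrite yx eqxx in xy.
move=> B B0 [O oO BO] [C cC BC].
have clQ := @closed_quasi_component T x.
have cB : closed B by rewrite BC; exact: closedI.
have cA : closed (quasi_component x `&` ~` O).
  by apply: closedI => //; exact: open_closedC.
have AB0 : (quasi_component x `&` ~` O) `&` B = set0.
  by apply/seteqP; split=> z // [[_ nOz]]; rewrite BO => -[].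
have QAB : quasi_component x `<=` (quasi_component x `&` ~` O) `|` B.
  by move=> z Qz; case: (pselect (O z)) => Oz; [right; rewrite BO | left].
(* The piece containing [x] plays the role of [A] in [quasi_component_split], so the other piece is
   empty: either [B] is everything, or [B0] is contradicted. *)
have [Ox|nOx] := pselect (O x).
- have Bx : B x by rewrite BO.
  have QA0 := @quasi_component_split T x B _ hT cT cB cA.
  rewrite setUC in QAB; rewrite setIC in AB0.
  have {}QA0 := QA0 QAB AB0 Bx.
  apply/seteqP; split=> z; first by rewrite BO => -[].
  move=> Qz; rewrite BO; split=> //; apply: contrapT => nOz.
  have : (quasi_component x `&` (quasi_component x `&` ~` O)) z by [].
  by rewrite QA0.
- have QB0 := quasi_component_split hT cT cA cB QAB AB0 (conj Qx nOx).
  case: B0 => z Bz; have : (quasi_component x `&` B) z.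
    by split=> //; move: Bz; rewrite BO => -[].
  by rewrite QB0.
Qed.

(** * Continuity of the group operations and open subgroups *)

Section TopGroupContinuity.
Context (G : topGroupType).
Implicit Types a x y : G.

Lemma cvg_mul (I : Type) (F : set_system I) (FF : Filter F) (f g : I -> G) x y :
  f @ F --> x -> g @ F --> y -> (fun i => f i * g i) @ F --> x * y.
Proof.
move=> fx gy; apply: (@continuous2_cvg _ _ _ _ _ _ f g mul) => //.
exact: (mulg_continuous (x, y)).
Qed.

Lemma cvg_inv (I : Type) (F : set_system I) (FF : Filter F) (f : I -> G) x :
  f @ F --> x -> (fun i => (f i)^-1) @ F --> x^-1.
Proof.
move=> fx.
exact: (@continuous_cvg I G G F FF f (fun y => y^-1) x (@invg_continuous G x) fx).
Qed.

Lemma continuous_mull a : continuous (fun x => a * x).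
Proof. by move=> x; apply: cvg_mul; [exact: cvg_cst | exact: cvg_id]. Qed.

Lemma continuous_conj a : continuous (fun x => x ^ a).
Proof.
move=> x; apply: cvg_mul; first exact: cvg_cst.
by apply: cvg_mul; [exact: cvg_id | exact: cvg_cst].
Qed.

Lemma continuous_comm a : continuous (fun x => [~ x, a]).
Proof.
move=> x; apply: cvg_mul; first by apply: cvg_inv; exact: cvg_id.
exact: continuous_conj.
Qed.

Lemma open_subgroup (H : subgroup G) : nbhs (1 : G) H -> open H.
Proof.
move=> nH; rewrite openE => x Hx.
have : nbhs x ((fun y => x^-1 * y) @^-1` H).
  by apply: (continuous_mull (a := x^-1)); rewrite mulVg.
apply: filterS => y /= Hy.
by rewrite -[y](mulKg x^-1) invgK; exact: subgroupM.
Qed.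

Lemma open_subgroup_closed (H : subgroup G) : open H -> closed H.
Proof.
move=> oH x clHx.
have : nbhs x ((fun y => x^-1 * y) @^-1` H).
  apply: (continuous_mull (a := x^-1)); rewrite mulVg.
  by apply: open_nbhs_nbhs; split=> //; exact: subgroup1.
move=> /clHx[y [Hy /= Hxy]].
have -> : x = y * (x^-1 * y)^-1 by rewrite invgM invgK mulgA mulgV mul1g.
exact: subgroupF.
Qed.

Lemma open_nbhs1 (H : subgroup G) : open H -> nbhs (1 : G) H.
Proof. by move=> oH; apply: open_nbhs_nbhs; split=> //; exact: subgroup1. Qed.

End TopGroupContinuity.

Section OpenNormalBase.
Context (G : topGroupType) (profG : profinite G).

Section Stabiliser.
Context (D : set G).

(* the normal core of the right stabiliser of D *)
Definition stabiliser_core : set G :=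
  [set h | forall g x, D x <-> D (x * h ^ g)].

Fact stabiliser_core1 : stabiliser_core 1.
Proof. by move=> g x; rewrite conj1g mulg1. Qed.

Fact stabiliser_coreF h k :
  stabiliser_core h -> stabiliser_core k -> stabiliser_core (h / k).
Proof.
move=> Dh Dk g x; rewrite conjMg mulgA conjVg (Dh g x).
by rewrite (Dk g (x * h ^ g * (k ^ g)^-1)) mulgVK.
Qed.

Fact stabiliser_coreJ : normalised_by [set: G] stabiliser_core.
Proof. by move=> h y Dh _ g x; rewrite -conjgM; exact: Dh. Qed.

Definition stabiliser_core_subgroup : normal_subgroup G :=
  @NormalSubgroup G (Subgroup stabiliser_core1 stabiliser_coreF)
    stabiliser_coreJ.

End Stabiliser.

(** The witness is the normal core of the stabiliser of a clopen [D] inside [A] containing 1. It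
    lies in [D] because it sends 1 into [D], and compactness makes it a neighbourhood of 1. *)
Lemma open_normal_base (A : set G) : nbhs (1 : G) A ->
  exists U : normal_subgroup G, open U /\ U `<=` A.
Proof.
case: profG => cG hG dG nA.
have zG := totally_disconnected_zero_dimensional cG hG dG.
have [D [D1 [oD cD]] DA] := zero_dimensional_cvg hG zG cG nA.
exists (stabiliser_core_subgroup D); split; last first.
  by move=> h /(_ 1 1); rewrite mul1g conjg1 => -[+ _] => /(_ D1) /DA.
apply: open_subgroup.
have cGG := compact_setX cG cG; rewrite setXTT in cGG.
(* Tube argument: it suffices to work near each triple [(g, x, 1)]. As [D] and its complement are
   both open, [x] and [x * h ^ g] stay on the same side there. *)
suff : \forall h \near nbhs (1 : G), [set: G * G] `<=`
    (fun gx => D gx.2 <-> D (gx.2 * h ^ gx.1)).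
  by apply: filterS => h Dh g x; exact: (Dh (g, x)).
apply: ((compact_near_coveringP _).1 cGG G (nbhs (1 : G))) => -[g x] _ /=.
have snd_x : (fun z : (G * G) * G => z.1.2) @ nbhs ((g, x), (1 : G)) --> x.
  apply: (@cvg_comp _ _ _ fst snd _ (nbhs (g, x))); first exact: cvg_fst.
  exact: cvg_snd.
have fst_g : (fun z : (G * G) * G => z.1.1) @ nbhs ((g, x), (1 : G)) --> g.
  by apply: (@cvg_comp _ _ _ fst fst _ (nbhs (g, x))); exact: cvg_fst.
have lim : (fun z : (G * G) * G => z.1.2 * z.2 ^ z.1.1)
    @ nbhs ((g, x), (1 : G)) --> x.
  rewrite -[X in _ --> X]mulg1 -[X in x * X](conj1g g).
  apply: cvg_mul => //; apply: cvg_mul; first exact: cvg_inv.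
  by apply: cvg_mul => //; exact: cvg_snd.
case: (pselect (D x)) => Dx.
  have nD : nbhs x D by apply: open_nbhs_nbhs.
  have sD : \forall z \near nbhs ((g, x), (1 : G)), D z.1.2 := snd_x _ nD.
  have lD : \forall z \near nbhs ((g, x), (1 : G)), D (z.1.2 * z.2 ^ z.1.1) :=
    lim _ nD.
  by apply: filterS2 sD lD => z.
have nD : nbhs x (~` D).
  by apply: open_nbhs_nbhs; split=> //; exact: closed_openC.
have sD : \forall z \near nbhs ((g, x), (1 : G)), (~` D) z.1.2 := snd_x _ nD.
have lD : \forall z \near nbhs ((g, x), (1 : G)),
  (~` D) (z.1.2 * z.2 ^ z.1.1) := lim _ nD.
by apply: filterS2 sD lD => z.
Qed.

End OpenNormalBase.

(** * Finite quotients *)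

Section FiniteGroupType.
Context (Q : groupType).

(** The alias carries the finiteness proof, so that a finite group structure can be attached to
    it. *)
Definition fin_group_type (_ : finite_set [set: Q]) : Type := Q.

Context (finQ : finite_set [set: Q]).
Local Notation T := (fin_group_type finQ).

HB.instance Definition _ := Group.copy T Q.

Definition fin_group_enum : seq T :=
  undup (sval (cid ((@finite_seqP Q [set: Q]).1 finQ))).

Lemma mem_fin_group_enum (x : T) : x \in fin_group_enum.
Proof.
rewrite mem_undup; case: cid => s /= sT.
by have : [set` s] x by rewrite -sT.
Qed.

Fact fin_group_pickleK :
  pcancel (fun x : T => index x fin_group_enum)
    (fun n => nth None (map Some fin_group_enum) n).
Proof.
move=> x; have xs := mem_fin_group_enum x.
by rewrite (nth_map x) ?index_mem // nth_index.
Qed.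

HB.instance Definition _ := Choice_isCountable.Build T fin_group_pickleK.

Fact fin_group_enumP : Finite.axiom fin_group_enum.
Proof.
by move=> x; rewrite count_uniq_mem ?undup_uniq // mem_fin_group_enum.
Qed.

HB.instance Definition _ := isFinite.Build T fin_group_enumP.

Lemma fin_group_type_card : ([set: Q] #= `I_#|{: T}|)%card.
Proof.
rewrite (card_eqr card_II).
have <- : (enum_rank : T -> _) @` [set: T] = [set: 'I_#|{: T}|].
  by apply/seteqP; split=> // i _; exists (enum_val i); rewrite ?enum_valK.
by apply: card_esym; apply: inj_card_eq => x y _ _; exact: enum_rank_inj.
Qed.

End FiniteGroupType.

Section FiniteQuotient.
Context (G : topGroupType) (cG : compact [set: G]).
Context (U : normal_subgroup G) (oU : open U).

Lemma pi_quotientM (N : normal_subgroup G) :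
  {morph (\pi_(quotient_group N) : G -> _) : x y / x * y}.
Proof. by move=> x y; rewrite -quotient_mulE. Qed.

Lemma pi_quotient1P (N : normal_subgroup G) (x : G) :
  \pi_(quotient_group N) x = 1 <-> subgroup_set N x.
Proof.
rewrite (_ : 1 = \pi_(quotient_group N) 1) //.
split=> [/esym/pi_quotientP|Nx]; first by rewrite invg1 mul1g.
by apply/esym/pi_quotientP; rewrite invg1 mul1g.
Qed.

(** Otherwise the preimages of cofinite sets of cosets generate a proper filter on [G]; at a cluster
    point [x] the open coset of [x] would meet the complement of itself. *)
Lemma finite_open_quotient : finite_set [set: quotient_group U].
Proof.
apply: contrapT => infQ.
pose F := filter_from [set A : set (quotient_group U) | finite_set A]
  (fun A => \pi_(quotient_group U) @^-1` (~` A)).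
have FF : ProperFilter F.
  apply: filter_from_proper.
    apply: filter_from_filter; first by exists set0 => /=.
    move=> A B fA fB; exists (A `|` B); first by rewrite /= finite_setU.
    by move=> x /= /not_orP[].
  move=> A fA; have /existsNP[q nAq] : ~ forall q, A q.
    by move=> AT; apply: infQ; apply: sub_finite_set fA => q _; exact: AT.
  by exists (repr q); rewrite /= reprK.
have [|x [_ Fx]] := @cG F FF; first by exists set0 => //=; exact: finite_set0.
have nU : nbhs x ((fun y => x^-1 * y) @^-1` U).
  by apply: (continuous_mull (a := x^-1)); rewrite mulVg; exact: open_nbhs1.
have FU : F (\pi_(quotient_group U) @^-1` (~` [set \pi_(quotient_group U) x])).
  by exists [set \pi_(quotient_group U) x] => //=; exact: finite_set1.
have [y [/= nxy Uxy]] := Fx _ _ FU nU.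
by apply: nxy; apply/esym/pi_quotientP.
Qed.

(** Gives access to finite group theory through a surjection onto a [finGroupType]; the cardinality
    clause connects it with the definition of [pro_p]. *)
Lemma finite_quotient_morphism :
  exists (gT : finGroupType) (f : G -> gT),
    [/\ {morph f : x y / x * y}, forall x, f x = 1 <-> subgroup_set U x,
        forall y, exists x, f x = y &
        ([set: quotient_group U] #= `I_#|gT|)%card].
Proof.
exists (fin_group_type finite_open_quotient), (\pi_(quotient_group U)); split.
- exact: pi_quotientM.
- exact: pi_quotient1P.
- by move=> y; exists (repr (y : quotient_group U)); rewrite reprK.
- exact: fin_group_type_card.
Qed.

End FiniteQuotient.

Lemma subgroupX (G : groupType) (H : subgroup G) (x : G) n :
  subgroup_set H x -> subgroup_set H (x ^+ n).
Proof.
move=> Hx; elim: n => [|n IH]; first by rewrite expg0; exact: subgroup1.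
by rewrite expgS; exact: subgroupM.
Qed.

Lemma subgroupJ (G : groupType) (H : subgroup G) (x y : G) :
  subgroup_set H x -> subgroup_set H y -> subgroup_set H (x ^ y).
Proof.
by move=> Hx Hy; apply: subgroupM; [exact: subgroupV | exact: subgroupM].
Qed.

Lemma subgroupR (G : groupType) (H : subgroup G) (x y : G) :
  subgroup_set H x -> subgroup_set H y -> subgroup_set H [~ x, y].
Proof.
by move=> Hx Hy; apply: subgroupM; [exact: subgroupV | exact: subgroupJ].
Qed.

Section GroupMorphism.
Context (G H : groupType) (f : G -> H) (fM : {morph f : x y / x * y}).

Lemma gmorph1 : f 1 = 1.
Proof. by apply: (mulgI (f 1)); rewrite -fM !mulg1. Qed.

Lemma gmorphV x : f x^-1 = (f x)^-1.
Proof. by apply: (mulgI (f x)); rewrite -fM !mulgV gmorph1. Qed.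

Lemma gmorphX x n : f (x ^+ n) = f x ^+ n.
Proof. by elim: n => [|n IH]; rewrite ?gmorph1 // !expgS fM IH. Qed.

Lemma gmorphJ x y : f (x ^ y) = f x ^ f y.
Proof. by rewrite !conjgE !fM gmorphV. Qed.

Lemma gmorphR x y : f [~ x, y] = [~ f x, f y].
Proof. by rewrite !commgEl fM gmorphV gmorphJ. Qed.

End GroupMorphism.

Lemma open_subgroup_expg (G : topGroupType) (cG : compact [set: G])
    (U : normal_subgroup G) (x : G) : open U ->
  exists n, (0 < n)%N /\ subgroup_set U (x ^+ n).
Proof.
move=> oU; have [gT [f [fM fU _ _]]] := finite_quotient_morphism cG oU.
exists #[f x]; split; first exact: fingroup.order_gt0.
by apply/fU; rewrite (gmorphX fM) expg_order.
Qed.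

(** Cosets of open normal subgroups form a base of neighbourhoods, so closedness can be tested in
    the finite quotients. *)
Lemma closed_open_normalP (G : topGroupType) (A : set G) : profinite G ->
  closed A <-> forall x : G, (forall U : normal_subgroup G, open U ->
    exists2 a, A a & subgroup_set U (a^-1 * x)) -> A x.
Proof.
move=> profG; split=> [cA x Ax|Acl x clx]; last first.
  apply: Acl => U oU.
  have : nbhs x ((fun a => a^-1 * x) @^-1` U).
    apply: (_ : (fun a => a^-1 * x) @ nbhs x --> x^-1 * x).
      by apply: cvg_mul; [apply: cvg_inv; exact: cvg_id | exact: cvg_cst].
    by rewrite mulVg; exact: open_nbhs1.
  by move=> /clx[a [Aa Ua]]; exists a.
apply: cA => B nB.
have nB' : nbhs (1 : G) ((fun u => x * u^-1) @^-1` B).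
  apply: (_ : (fun u => x * u^-1) @ nbhs (1 : G) --> x * 1^-1).
    by apply: cvg_mul; [exact: cvg_cst | apply: cvg_inv; exact: cvg_id].
  by rewrite invg1 mulg1.
have [U [oU UB]] := open_normal_base profG nB'.
have [a Aa /UB /=] := Ax U oU.
by rewrite invgM invgK mulgA mulgV mul1g => Ba; exists a.
Qed.

(** * Closed subgroups and p-parts of elements *)

Lemma expg_modn (G : groupType) (x : G) (d i : nat) :
  x ^+ d = 1 -> x ^+ i = x ^+ (i %% d).
Proof.
by move=> xd; rewrite {1}(divn_eq i d) expgnDr mulnC expgnA xd expg1n mul1g.
Qed.

Section SubgroupType.
Context (G : topGroupType) (H : subgroup G).
Local Notation T := (subgroup_type H).

Lemma val_subgroup_continuous : continuous (val : T -> G).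
Proof. exact: (@initial_continuous _ _ (set_val : set_type H -> G)). Qed.

Lemma val_subgroupM : {morph (val : T -> G) : x y / x * y}.
Proof. by []. Qed.

Lemma val_subgroupP (t : T) : subgroup_set H (val t).
Proof. exact: set_valP. Qed.

Lemma subgroup_typeP (x : G) : subgroup_set H x -> exists t : T, val t = x.
Proof. by move=> /mem_set Hx; exists (Sub x Hx); exact: SubK. Qed.

Lemma nbhs_subgroup (t : T) (W : set T) : nbhs t W ->
  exists2 B : set G, nbhs (val t) B & forall u : T, B (val u) -> W u.
Proof.
rewrite nbhsE => -[V [[B oB <-] Bt] VW].
by exists B => //; apply: open_nbhs_nbhs.
Qed.

Lemma compact_subgroup_type :
  compact [set: G] -> closed H -> compact [set: T].
Proof.
move=> cG cH F FF _.
pose F' := (val : T -> G) @ F.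
have F'H : F' H.
  apply: (@filterS _ F _ setT) => [t _|]; first exact: val_subgroupP.
  exact: filterT.
have [z [Hz Fz]] := @subclosed_compact _ _ _ cH cG (@subsetT _ _) F' _ F'H.
have [t tz] := subgroup_typeP Hz.
exists t; split=> // A B FA /nbhs_subgroup[B' nB' B'B].
have F'A : F' ((val : T -> G) @` A).
  by apply: (@filterS _ F _ A) => // u Au; exists u.
rewrite tz in nB'.
by have [_ [[u Au <-] Bu]] := Fz _ _ F'A nB'; exists u; split=> //; exact: B'B.
Qed.

Lemma hausdorff_subgroup_type : hausdorff_space G -> hausdorff_space T.
Proof.
move=> hG s t st; apply: val_inj; apply: hG => A B nA nB.
have [u [Au Bu]] := st _ _ (val_subgroup_continuous nA)
  (val_subgroup_continuous nB).
by exists (val u).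
Qed.

Lemma profinite_subgroup_type : profinite G -> closed H -> profinite T.
Proof.
case=> cG hG dG cH; split.
- exact: compact_subgroup_type.
- exact: hausdorff_subgroup_type.
apply: zero_dimension_totally_disconnected => s t st.
have [|D [[oD cD] Ds Dt]] :=
  totally_disconnected_zero_dimensional cG hG dG (x := val s) (y := val t).
  by apply: contra_neq st; exact: val_inj.
exists (val @^-1` D); split=> //; split.
  by apply: open_comp => // u _; exact: val_subgroup_continuous.
by apply: preimage_closed => // u _; exact: val_subgroup_continuous.
Qed.

End SubgroupType.

Section SubgroupMul.
Context (G : groupType) (H : subgroup G) (N : normal_subgroup G).

(** The product [H N], described by cosets of [N]. *)
Definition subgroup_mul_set : set G :=
  [set g | exists2 h, subgroup_set H h & subgroup_set N (h^-1 * g)].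

Fact subgroup_mul1 : subgroup_mul_set 1.
Proof. by exists 1; rewrite ?invg1 ?mul1g; exact: subgroup1. Qed.

Fact subgroup_mulF x y :
  subgroup_mul_set x -> subgroup_mul_set y -> subgroup_mul_set (x / y).
Proof.
move=> [h Hh Nx] [k Hk Ny]; exists (h / k); first exact: subgroupF.
have -> : (h / k)^-1 * (x / y) = ((h^-1 * x) / (k^-1 * y)) ^ k^-1.
  by rewrite conjgE !invgM !invgK !mulgA mulgK.
by apply: normalJ => //; exact: subgroupF.
Qed.

Definition subgroup_mul : subgroup G := Subgroup subgroup_mul1 subgroup_mulF.

End SubgroupMul.

(** The exponents that send [x] into [S] are multiples of the least positive one, [d]. For every
    prime some exponent avoids it, so no prime divides [d] and [d = 1]. *)
Lemma minimal_exponent (G : groupType) (S : subgroup G) (x : G) (n : nat) :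
  (0 < n)%N -> subgroup_set S (x ^+ n) ->
  (forall p, prime p -> exists2 a, ~~ (p %| a)%N & subgroup_set S (x ^+ a)) ->
  subgroup_set S x.
Proof.
move=> n0 Sn Sp.
have exd : exists d, (0 < d)%N && `[< subgroup_set S (x ^+ d) >].
  by exists n; rewrite n0; apply/asboolP.
have [d /andP[d0 /asboolP Sd] dmin] := ex_minnP exd.
have dvd_d a : subgroup_set S (x ^+ a) -> (d %| a)%N.
  move=> Sa; rewrite /dvdn; have [//|r0] := posnP (a %% d).
  have := ltn_pmod a d0; rewrite ltnNge => /negP[].
  apply: dmin; rewrite r0; apply/asboolP.
  have -> : x ^+ (a %% d) = (x ^+ d ^+ (a %/ d))^-1 * x ^+ a.
    suff -> : x ^+ a = x ^+ d ^+ (a %/ d) * x ^+ (a %% d) by rewrite mulKg.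
    by rewrite -expgnA -expgnDr mulnC -divn_eq.
  by apply: subgroupM => //; apply: subgroupV; exact: subgroupX.
case: (ltngtP d 1) => [|d1|d1]; first by rewrite ltnNge d0.
  have [a npa Sa] := Sp _ (pdiv_prime d1).
  by rewrite (dvdn_trans (pdiv_dvd d) (dvd_d a Sa)) in npa.
by rewrite d1 expg1 in Sd.
Qed.

Definition p_element (p : nat) (G : topGroupType) (x : G) : Prop :=
  forall U : normal_subgroup G, open U ->
    exists k, subgroup_set U (x ^+ (p ^ k)%N).

Lemma p_q_element1 (G : topGroupType) (p q : nat) (x : G) : profinite G ->
  prime p -> prime q -> p != q -> p_element p x -> p_element q x -> x = 1.
Proof.
move=> profG pp pq npq px qx.
have c1 : closed [set (1 : G)].
  by apply: accessible_closed_set1; apply: hausdorff_accessible; case: profG.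
apply: ((closed_open_normalP _ profG).1 c1) => U oU.
exists 1 => //; rewrite invg1 mul1g.
have [k Uk] := px U oU; have [l Ul] := qx U oU.
apply: (minimal_exponent _ Uk); first by rewrite expn_gt0 prime_gt0.
(* The exponent [q ^ l] is prime to [p], and [p ^ k] is prime to every other prime. *)
move=> r pr; have [rp|nrp] := eqVneq r p.
  exists (q ^ l)%N => //; rewrite Euclid_dvdX //.
  by rewrite rp dvdn_prime2 // (negPf npq).
by exists (p ^ k)%N => //; rewrite Euclid_dvdX // dvdn_prime2 // (negPf nrp).
Qed.

Section PPart.
Context (G : topGroupType) (profG : profinite G) (p : nat) (pp : prime p).

(* [= 1] modulo the p-part of [n`!] and [= 0] modulo its p'-part, so that
   [y ^+ p_exponent n] tends to the p-part of [y] *)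
Definition p_exponent (n : nat) : nat := chinese (n`!)`_p (n`!)`_(negn p) 1 0.

Lemma p_exponent_dvd n : (n`! %| p_exponent n * (n`!)`_p)%N.
Proof.
rewrite -{1}(partnC p (fact_gt0 n)) mulnC dvdn_mul //.
have := chinese_modr (coprime_partC p n`! n`!) 1 0.
by rewrite mod0n => /eqP.
Qed.

Lemma p_exponent_mod n k :
  (p ^ k %| n`!)%N -> (p_exponent n %% p ^ k = 1 %% p ^ k)%N.
Proof.
move=> pkn; have dvd : (p ^ k %| n`!`_p)%N.
  by rewrite p_part dvdn_exp2l // -pfactor_dvdn ?fact_gt0.
rewrite -(modn_dvdm _ dvd) -[in RHS](modn_dvdm _ dvd).
by rewrite (chinese_modl (coprime_partC p n`! n`!)).
Qed.

(** [z] is a cluster point of the powers [y ^+ p_exponent n]. Modulo a given [U] it agrees with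
    terms of arbitrarily large index, and each clause is read off from such a term. *)
Lemma p_part_exists (y : G) : exists z : G,
  [/\ p_element p z,
      forall U : normal_subgroup G, open U -> exists2 a,
        ~~ (p %| a)%N & subgroup_set U (z^-1 * y ^+ a),
      forall (U : normal_subgroup G) k, open U ->
        subgroup_set U (y ^+ (p ^ k)%N) -> subgroup_set U (z^-1 * y) &
      forall H : subgroup G, closed H -> subgroup_set H y -> subgroup_set H z].
Proof.
have cG : compact [set: G] by case: profG.
pose F := (fun n => y ^+ p_exponent n) @ \oo.
have [|z [_ Fz]] := @cG F _; first exact: filterT.
have limz (U : normal_subgroup G) N : open U ->
    exists2 n, (N <= n)%N & subgroup_set U (z^-1 * y ^+ p_exponent n).
  move=> oU; have FN : F [set y ^+ p_exponent n | n in [set n | (N <= n)%N]].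
    by exists N => // n /= Nn; exists n.
  have nU : nbhs z ((fun w => z^-1 * w) @^-1` U).
    by apply: (continuous_mull (a := z^-1)); rewrite mulVg; exact: open_nbhs1.
  by have [_ [[n Nn <-] Un]] := Fz _ _ FN nU; exists n.
have piE (U : normal_subgroup G) x w : subgroup_set U (x^-1 * w) ->
    \pi_(quotient_group U) x = \pi_(quotient_group U) w.
  by move=> /pi_quotientP.
exists z; split.
- move=> U oU; have [N [N0 UN]] := open_subgroup_expg cG y oU.
  (* Since [N <= n], the order of [y] modulo [U] divides the factorial of [n], so the p-part of that
     factorial kills [y ^+ p_exponent n] modulo [U]. *)
  have [n Nn Un] := limz U N oU; exists (logn p n`!).
  apply/pi_quotient1P; rewrite (gmorphX (@pi_quotientM _ U)) (piE _ _ _ Un).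
  rewrite -(gmorphX (@pi_quotientM _ U)); apply/pi_quotient1P.
  have /dvdnP[q qE] : (N %| p_exponent n * p ^ logn p n`!)%N.
    by rewrite -p_part (dvdn_trans _ (p_exponent_dvd n)) // dvdn_fact ?N0.
  by rewrite -expgnA qE mulnC expgnA; exact: subgroupX.
- move=> U oU; have [n pn Un] := limz U p oU.
  exists (p_exponent n) => //.
  have /p_exponent_mod : (p ^ 1 %| n`!)%N.
    by rewrite expn1 dvdn_fact // prime_gt0.
  rewrite expn1 /dvdn => ->; rewrite modn_small ?prime_gt1 //.
(* For [n] at least [p ^ k] the exponent is 1 modulo [p ^ k], so it fixes [y] modulo [U]. *)
- move=> U k oU Uk; have [n pn Un] := limz U (p ^ k)%N oU.
  apply/pi_quotientP; rewrite (piE _ _ _ Un) (gmorphX (@pi_quotientM _ U)).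
  have yk : \pi_(quotient_group U) y ^+ (p ^ k)%N = 1.
    by rewrite -(gmorphX (@pi_quotientM _ U)); apply/pi_quotient1P.
  rewrite (expg_modn _ yk) p_exponent_mod -?(expg_modn _ yk) ?expg1 //.
  by rewrite dvdn_fact // expn_gt0 prime_gt0.
- move=> H cH Hy; apply: ((closed_open_normalP _ profG).1 cH) => U oU.
  have [n _ Un] := limz U 0%N oU; exists (y ^+ p_exponent n).
    exact: subgroupX.
  by have := subgroupV Un; rewrite invgM invgK.
Qed.

End PPart.

(** * Pro-p and pronilpotent subgroups *)

Section Preimage.
Context (G H : groupType) (f : G -> H) (fM : {morph f : x y / x * y}).

Fact preimage_subgroup1 (K : subgroup H) : (f @^-1` K) 1.
Proof. by rewrite /= (gmorph1 fM); exact: subgroup1. Qed.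

Fact preimage_subgroupF (K : subgroup H) x y :
  (f @^-1` K) x -> (f @^-1` K) y -> (f @^-1` K) (x / y).
Proof. by rewrite /= fM (gmorphV fM); exact: subgroupF. Qed.

Definition preimage_subgroup (K : subgroup H) : subgroup G :=
  Subgroup (preimage_subgroup1 K) (@preimage_subgroupF K).

Fact preimage_subgroupJ (K : normal_subgroup H) :
  normalised_by [set: G] (preimage_subgroup K).
Proof.
by move=> x y Kx _; rewrite /= (gmorphJ fM); exact: normalJ.
Qed.

Definition preimage_normal (K : normal_subgroup H) : normal_subgroup G :=
  NormalSubgroup (@preimage_subgroupJ K).

End Preimage.

Lemma p_element_morph (G H : topGroupType) (f : G -> H) (p : nat) (x : G) :
  {morph f : x y / x * y} -> continuous f ->
  p_element p x -> p_element p (f x).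
Proof.
move=> fM fC px U oU.
have [|k Uk] := px (preimage_normal fM U).
  by apply: open_comp => // y _; exact: fC.
by exists k; rewrite -(gmorphX fM).
Qed.

Lemma p_elt_expg (gT : finGroupType) (p k : nat) (x : gT) :
  prime p -> x ^+ (p ^ k)%N = 1 -> p.-elt x.
Proof.
move=> pp xk; apply: (@pnat_dvd _ (p ^ k)%N).
  by rewrite order_dvdn; apply/eqP.
by rewrite pnatX pnat_id.
Qed.

Lemma p_elt_expgP (gT : finGroupType) (p : nat) (x : gT) :
  p.-elt x -> exists k, x ^+ (p ^ k)%N = 1.
Proof.
by move=> /p_natP[k xk]; exists k; rewrite -xk expg_order.
Qed.

Lemma pro_p_element (G : topGroupType) (p : nat) (x : G) :
  pro_p p G -> p_element p x.
Proof.
case=> -[cG _ _] pG U oU.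
have [gT [f [fM fU _ cardU]]] := finite_quotient_morphism cG oU.
have [k cardk] := pG U oU; exists k.
have /card_eq_II <- : (`I_#|gT| #= `I_(p ^ k))%card.
  by apply: card_eq_trans cardk; exact: card_esym.
apply/fU; rewrite (gmorphX fM); apply/eqP; rewrite -order_dvdn.
by have := order_dvdG (finset.in_setT (f x)); rewrite finset.cardsT.
Qed.

(** By Cauchy, a prime dividing the order of a finite quotient is the order of the image of some
    p-element, hence equals [p]. *)
Lemma p_elements_pro_p (G : topGroupType) (p : nat) : prime p ->
  profinite G -> (forall x : G, p_element p x) -> pro_p p G.
Proof.
move=> pp profG pG; split=> // U oU; have cG : compact [set: G] by case: profG.
have [gT [f [fM fU fsurj cardU]]] := finite_quotient_morphism cG oU.
suff /p_natP[k pk] : p.-nat #|gT| by exists k; rewrite -pk.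
rewrite -finset.cardsT; apply/pgroupP => q pq /(Cauchy pq)[y _ oy].
have [x xy] := fsurj y; have [k Uk] := pG x U oU.
have /(p_elt_expg pp) : y ^+ (p ^ k)%N = 1.
  by rewrite -xy -(gmorphX fM); apply/fU.
by rewrite /p_elt oy pnatE.
Qed.

Section FiniteNilpotent.
Context (gT : finGroupType) (A : {group gT}).

(** In a nilpotent group the p-elements are exactly the members of ['O_p(A)]. *)
Lemma nilpotent_p_eltM (p : nat) (x y : gT) : nilpotent A ->
  x \in A -> y \in A -> p.-elt x -> p.-elt y -> p.-elt (x * y).
Proof.
move=> nilA Ax Ay; have hallA := nilpotent_pcore_Hall p nilA.
have memA z : z \in A -> (z \in 'O_p(A)) = p.-elt z.
  by move=> Az; apply: (mem_normal_Hall hallA) => //; exact: pcore_normal.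
by move=> px py; rewrite -memA ?groupM // memA.
Qed.

Lemma nilpotent_der1_central : A^`(1) \subset 'Z(A) -> nilpotent A.
Proof.
move=> sAZ; rewrite -quotient_center_nil; apply: abelian_nil.
by apply: sub_der1_abelian.
Qed.

(** The central quotient is a p-group: an element of prime order [q] other than [p] in it is the
    image of the q-part of a lift, which is central. *)
Lemma nilpotent_p'_elt_central (p : nat) :
  (forall q a, prime q -> q != p -> a \in A -> q.-elt a -> a \in 'Z(A)) ->
  nilpotent A.
Proof.
move=> cA; rewrite -quotient_center_nil; apply: (@pgroup_nil _ p).
apply/pgroupP => q pq /(Cauchy pq)[ya /morphimP[a na Aa ->] oy].
apply: contraTT (prime_gt1 pq) => nqp.
have Za : a.`_q \in 'Z(A).
  by apply: (cA q) => //; [exact: groupX | exact: p_elt_constt].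
have : (coset 'Z(A) a).`_q = 1.
  by rewrite -(morph_constt (coset_morphism 'Z(A))) //= coset_id.
rewrite constt_p_elt; last by rewrite /p_elt oy pnat_id.
by move=> /eqP; rewrite -order_eq1 oy => /eqP->.
Qed.

End FiniteNilpotent.

Section ImageGroup.
Context (G : groupType) (gT : finGroupType) (f : G -> gT).
Context (fM : {morph f : x y / x * y}) (N : subgroup G).

Definition image_set : {set gT} :=
  finset (fun y => `[< exists2 x, subgroup_set N x & f x = y >]).

Lemma image_setP y :
  reflect (exists2 x, subgroup_set N x & f x = y) (y \in image_set).
Proof. by rewrite inE; exact: asboolP. Qed.

Fact image_group_set : group_set image_set.
Proof.
apply/group_setP; split.
  by apply/image_setP; exists 1; [exact: subgroup1 | exact: gmorph1].
move=> _ _ /image_setP[x Nx <-] /image_setP[y Ny <-]; apply/image_setP.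
by exists (x * y); [exact: subgroupM | exact: fM].
Qed.

Definition image_group : {group gT} := group image_group_set.

End ImageGroup.

(* The image of [N] in every finite quotient of [G] has, for each prime [p], a
   set of [p]-elements closed under products, i.e. is nilpotent. *)
Definition pronilpotent (G : topGroupType) (N : set G) : Prop :=
  forall (U : normal_subgroup G) (p : nat) (x y : G),
    open U -> prime p -> N x -> N y ->
    (exists k, subgroup_set U (x ^+ (p ^ k)%N)) ->
    (exists k, subgroup_set U (y ^+ (p ^ k)%N)) ->
    exists k, subgroup_set U ((x * y) ^+ (p ^ k)%N).

Section Pronilpotent.
Context (G : topGroupType) (profG : profinite G).

Let cG : compact [set: G]. Proof. by case: profG. Qed.

Lemma nilpotent_images_pronilpotent (N : subgroup G) :
  (forall (U : normal_subgroup G) (gT : finGroupType) (f : G -> gT)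
     (fM : {morph f : x y / x * y}), open U ->
     (forall x, f x = 1 <-> subgroup_set U x) ->
     nilpotent (image_group fM N)) ->
  pronilpotent N.
Proof.
move=> nilN U p x y oU pp Nx Ny [k xk] [l yl].
have [gT [f [fM fU _ _]]] := finite_quotient_morphism cG oU.
have nilA := nilN U gT f fM oU fU.
have /p_elt_expgP[m xym] : p.-elt (f x * f y); last first.
  by exists m; apply/fU; rewrite (gmorphX fM) fM.
apply: (nilpotent_p_eltM nilA).
- by apply/image_setP; exists x.
- by apply/image_setP; exists y.
- by apply: (@p_elt_expg _ p k) => //; rewrite -(gmorphX fM); apply/fU.
- by apply: (@p_elt_expg _ p l) => //; rewrite -(gmorphX fM); apply/fU.
Qed.

Lemma class2_pronilpotent (N : subgroup G) :
  (forall x y z, subgroup_set N x -> subgroup_set N y -> subgroup_set N z ->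
     commute [~ x, y] z) ->
  pronilpotent N.
Proof.
move=> N2; apply: nilpotent_images_pronilpotent => U gT f fM oU fU.
apply: nilpotent_der1_central; rewrite finset.subsetI der_sub /= gen_subG.
apply/fintype.subsetP => _
  /imset2P[_ _ /image_setP[x Nx <-] /image_setP[y Ny <-] ->].
apply/centP => _ /image_setP[z Nz <-].
by rewrite /commute -(gmorphR fM) -!fM N2.
Qed.

Lemma p'_central_pronilpotent (N : subgroup G) (p : nat) : closed N ->
  (forall q x, prime q -> q != p -> subgroup_set N x -> p_element q x ->
     forall z, subgroup_set N z -> commute x z) ->
  pronilpotent N.
Proof.
move=> cN Np; apply: nilpotent_images_pronilpotent => U gT f fM oU fU.
apply: (@nilpotent_p'_elt_central _ _ p) => q _ pq nqp /image_setP[x Nx <-].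
move=> /p_elt_expgP[k]; rewrite -(gmorphX fM) => /fU xk.
(* A q-element of the image lifts to a q-element of [N], namely the q-part [z] of any lift [x], to
   which the hypothesis applies. *)
have [z [qz _ /(_ U k oU xk) /fU zx Hz]] := p_part_exists profG pq x.
have {}zx : f x = f z.
  by apply: (mulgI (f z)^-1); rewrite mulVg -(gmorphV fM) -fM.
have Nz := Hz N cN Nx; rewrite zx; apply/centerP; split.
  by apply/image_setP; exists z.
by move=> _ /image_setP[w Nw <-]; rewrite /commute -!fM (Np q z pq nqp Nz qz).
Qed.

(** An open subgroup of [K] contains the trace of a neighbourhood of 1 in [H]; its preimage under
    [f] contains an open normal subgroup of [G], where a p-power of [x] falls. *)
Lemma p_element_subgroup_type (H : topGroupType) (f : G -> H) (p : nat)
    (K : subgroup H) (x : G) (t : subgroup_type K) :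
  {morph f : a b / a * b} -> continuous f -> val t = f x ->
  p_element p x -> p_element p t.
Proof.
move=> fM fC tx px W oW; have [B nB BW] := nbhs_subgroup (open_nbhs1 oW).
have nB' : nbhs (1 : G) (f @^-1` B) by apply: fC; rewrite (gmorph1 fM).
have [U [oU UB]] := open_normal_base profG nB'.
have [k /UB Uk] := px U oU; exists k; apply: BW.
by rewrite (gmorphX (@val_subgroupM _ K)) tx -(gmorphX fM).
Qed.

Section Sylow.
Context (N : normal_subgroup G) (nilN : pronilpotent N).
Context (p : nat) (pp : prime p).

(** The unique Sylow pro-p subgroup of [N]; pronilpotence is what makes it closed under products. *)
Definition sylow_set : set G := [set x | subgroup_set N x /\ p_element p x].

Fact sylow1 : sylow_set 1.
Proof.
by split=> [|U _]; [exact: subgroup1 | exists 0%N; exact: subgroup1].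
Qed.

Fact sylowF x y : sylow_set x -> sylow_set y -> sylow_set (x / y).
Proof.
move=> [Nx px] [Ny py]; split=> [|U oU]; first exact: subgroupF.
apply: nilN => //; [exact: subgroupV | exact: px |].
by have [k Uk] := py U oU; exists k; rewrite expVgn; exact: subgroupV.
Qed.

Fact sylowJ : normalised_by [set: G] sylow_set.
Proof.
move=> x y [Nx px] _; split=> [|U oU]; first exact: normalJ.
by have [k Uk] := px U oU; exists k; rewrite -conjXg; exact: normalJ.
Qed.

Definition sylow : normal_subgroup G :=
  @NormalSubgroup G (Subgroup sylow1 sylowF) sylowJ.

Lemma closed_sylow : closed N -> closed sylow.
Proof.
move=> cN; apply/(closed_open_normalP _ profG) => x xU; split.
  apply: ((closed_open_normalP _ profG).1 cN) => U /xU[a [Na _]].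
  by exists a.
move=> U oU; have [a [_ pa] /pi_quotientP Uax] := xU U oU.
have [k Uk] := pa U oU; exists k; apply/pi_quotient1P.
by rewrite (gmorphX (@pi_quotientM _ U)) -Uax -(gmorphX (@pi_quotientM _ U));
  apply/pi_quotient1P.
Qed.

Lemma sylow_p_core : closed N -> sylow `<=` p_core p G.
Proof.
move=> cN x Sx H cH; apply; exists sylow; split=> //; first exact: closed_sylow.
apply: p_elements_pro_p => //.
  by apply: profinite_subgroup_type => //; exact: closed_sylow.
move=> t; apply: (@p_element_subgroup_type G id p _ (val t)) => //.
  by move=> z; exact: cvg_id.
by case: (val_subgroupP t).
Qed.

End Sylow.

(** [N] is generated by its Sylow subgroups: modulo any [U], some power of [x] with exponent prime
    to [p] agrees with the p-part of [x], which lies in [p_core p G]. Then [minimal_exponent] puts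
    [x] in [H U], for every closed [H] containing all the p-cores. *)
Lemma pronilpotent_Fitting (N : normal_subgroup G) :
  closed N -> pronilpotent N -> N `<=` Fitting G.
Proof.
move=> cN nilN x Nx H cH FH.
apply: ((closed_open_normalP _ profG).1 cH) => U oU.
have [n [n0 Un]] := open_subgroup_expg cG x oU.
have : subgroup_set (subgroup_mul H U) x; last by case=> h; exists h.
apply: (minimal_exponent n0).
  by exists 1; [exact: subgroup1 | rewrite invg1 mul1g].
move=> p pp; have [z [pz /(_ U oU)[a npa Ua] _ Hz]] := p_part_exists profG pp x.
exists a => //; exists z => //; apply: FH; exists p; split=> //.
apply: (@sylow_p_core N nilN p pp cN); split=> //.
exact: Hz.
Qed.

End Pronilpotent.

(** * Quasisimple subgroups *)

Section Commutators.
Context (G : groupType).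
Implicit Types x y z w : G.

Lemma commgEmul x y : [~ x, y] = (y * x)^-1 * (x * y).
Proof. by rewrite commgEl conjgE invgM !mulgA. Qed.

Lemma hall_witt x y z :
  [~ [~ x, y^-1], z] ^ y * [~ [~ y, z^-1], x] ^ z * [~ [~ z, x^-1], y] ^ x = 1.
Proof.
rewrite !commgEl !conjgE !invgM !invgK !mulgA.
by rewrite !(mulgK, mulgVK, mulgV, mulVg, mul1g).
Qed.

(** Elementwise three subgroup lemma: two factors of the Hall-Witt identity vanish, hence so does
    the third. *)
Lemma three_commutators x y z :
  commute [~ y, z^-1] x -> commute [~ z, x^-1] y -> commute [~ x, y^-1] z.
Proof.
move=> /commgP/eqP yzx /commgP/eqP zxy; apply/commgP; apply/eqP.
have := hall_witt x y z; rewrite yzx zxy !conj1g !mulg1 => xyz.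
by apply: (@conjg_inj _ y); rewrite xyz conj1g.
Qed.

Lemma commg_mul_central x y z w :
  commute z x -> commute z y -> commute w x -> commute w y -> commute z w ->
  [~ x * z, y * w] = [~ x, y].
Proof.
move=> zx zy wx wy zw.
have E (a b c d : G) : commute c b -> (a * c) * (b * d) = (a * b) * (c * d).
  by move=> cb; rewrite -!mulgA; congr (a * _); rewrite !mulgA cb.
rewrite !commgEmul (E y x w z wx) (E x y z w zy) -zw; set t := z * w.
have tM (a b : G) : commute z a -> commute z b -> commute w a -> commute w b ->
    commute t (a * b).
  move=> za zb wa wb.
  by apply: commute_sym; apply: commuteM; apply: commute_sym; exact: commuteM.
have tyx : commute t (y * x)^-1 by apply: commuteV; exact: tM.
have -> : (y * x * t)^-1 * (x * y * t) = t^-1 * ((y * x)^-1 * (x * y) * t).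
  by rewrite !invgM !mulgA.
by rewrite -(commuteM tyx (tM x y zx zy wx wy)) mulKg.
Qed.

End Commutators.

Section SubgroupOperations.
Context (G : groupType).

Fact setI_subgroup1 (H K : subgroup G) : (H `&` K) 1.
Proof. by split; exact: subgroup1. Qed.

Fact setI_subgroupF (H K : subgroup G) x y :
  (H `&` K) x -> (H `&` K) y -> (H `&` K) (x / y).
Proof. by move=> [Hx Kx] [Hy Ky]; split; exact: subgroupF. Qed.

Definition setI_subgroup (H K : subgroup G) : subgroup G :=
  Subgroup (@setI_subgroup1 H K) (@setI_subgroupF H K).

Fact setI_normalJ (H K : normal_subgroup G) :
  normalised_by [set: G] (setI_subgroup H K).
Proof. by move=> x y [Hx Kx] _; split; exact: normalJ. Qed.

Definition setI_normal (H K : normal_subgroup G) : normal_subgroup G :=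
  NormalSubgroup (@setI_normalJ H K).

Fact centraliser1 (A : set G) : centraliser A 1.
Proof. by move=> y _; apply: commute_sym; exact: commute1. Qed.

Fact centraliserF (A : set G) x y :
  centraliser A x -> centraliser A y -> centraliser A (x / y).
Proof.
move=> Cx Cy z Az; apply: commute_sym; apply: commuteM.
  by apply: commute_sym; exact: Cx.
by apply: commuteV; apply: commute_sym; exact: Cy.
Qed.

Definition centraliser_subgroup (A : set G) : subgroup G :=
  Subgroup (@centraliser1 A) (@centraliserF A).

Lemma centraliserJ (A : set G) :
  normalised_by [set: G] A -> normalised_by [set: G] (centraliser A).
Proof.
move=> nA x y Cx _ z Az; apply: (@conjg_inj _ y^-1).
by rewrite /= conjMg (conjMg z) conjgK; apply: Cx; exact: nA.
Qed.

End SubgroupOperations.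

Section Generated.
Context (G : topGroupType).
Implicit Types (A : set G) (H : subgroup G).

Lemma generated_min A H : closed H -> A `<=` H -> generated A `<=` H.
Proof. by move=> cH AH x; apply. Qed.

Lemma sub_generated A : A `<=` generated A.
Proof. by move=> x Ax H _; apply. Qed.

Fact generated1 A : generated A 1.
Proof. by move=> H _ _; exact: subgroup1. Qed.

Fact generatedF A x y : generated A x -> generated A y -> generated A (x / y).
Proof. by move=> gx gy H cH AH; apply: subgroupF; [exact: gx | exact: gy]. Qed.

Definition generated_subgroup A : subgroup G :=
  Subgroup (@generated1 A) (@generatedF A).

Lemma closed_generated A : closed (generated A).
Proof.
rewrite [generated A](_ : _ =
  \bigcap_(H in [set H : subgroup G | closed H /\ A `<=` H]) subgroup_set H).
  by apply: closed_bigI => H [].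
apply/seteqP; split=> x gx H; first by move=> [cH AH]; exact: gx.
by move=> cH AH; exact: (gx H).
Qed.

Lemma conjgM_morph (y : G) : {morph (fun x => x ^ y) : a b / a * b}.
Proof. by move=> a b; exact: conjMg. Qed.

Lemma generatedJ A B :
  normalised_by B A -> normalised_by B (generated A).
Proof.
move=> nA x y gx By.
apply: (gx (preimage_subgroup (conjgM_morph y) (generated_subgroup A))).
  apply: preimage_closed; last exact: closed_generated.
  by move=> z _; exact: continuous_conj.
by move=> z Az; apply: sub_generated; exact: nA.
Qed.

Lemma closed_centraliser A : hausdorff_space G -> closed (centraliser A).
Proof.
move=> hG; rewrite [centraliser A](_ : _ =
  \bigcap_(y in A) ((fun x => [~ x, y]) @^-1` [set 1])).
  apply: closed_bigI => y _; apply: preimage_closed.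
    by move=> x _; exact: continuous_comm.
  by apply: accessible_closed_set1; exact: hausdorff_accessible.
apply/seteqP; split=> x Cx y Ay; first by apply/eqP/commgP; exact: Cx.
by apply/commgP; apply/eqP; exact: Cx.
Qed.

Lemma centraliser_generated A :
  hausdorff_space G -> centraliser A `<=` centraliser (generated A).
Proof.
move=> hG x Cx y gy; apply: commute_sym.
apply: (gy (centraliser_subgroup [set x])) => //.
  exact: closed_centraliser.
by move=> z Az _ ->; apply: commute_sym; exact: Cx.
Qed.

Definition commutators A : set G :=
  [set z | exists x y, [/\ A x, A y & z = [~ x, y]]].

End Generated.

Section QuotientTopology.
Context (G : topGroupType) (N : normal_subgroup G).
Local Notation pi := (\pi_(quotient_group N) : G -> quotient_group N).

Lemma continuous_pi_quotient : continuous pi.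
Proof. exact: (@pi_continuous G {eq_quot coset_equiv N}). Qed.

Lemma pi_quotient_surj (q : quotient_group N) : exists x : G, pi x = q.
Proof. by exists (repr q); rewrite reprK. Qed.

(** The saturation [A N] is the image of a compact set under multiplication, hence closed. *)
Lemma closed_pi_image (A : set G) : compact [set: G] -> hausdorff_space G ->
  closed N -> closed A -> closed (pi @` A).
Proof.
move=> cG hG cN cA; pose AN := (fun xy : G * G => xy.1 * xy.2) @` (A `*` N).
have cAN : closed AN.
  apply: compact_closed => //; apply: continuous_compact.
    by apply: continuous_subspaceT; exact: mulg_continuous.
  by apply: compact_setX; [exact: subclosed_compact cA cG _ |
    exact: subclosed_compact cN cG _].
suff E : pi @^-1` (~` (pi @` A)) = ~` AN.
  by rewrite -openC; change (open (pi @^-1` (~` (pi @` A)))); rewrite E openC.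
congr (~` _); apply/seteqP.
split=> [x [a Aa /pi_quotientP Nax]|_ [[a n] [/= Aa Nn] <-]].
  by exists (a, a^-1 * x); rewrite //= mulgA mulgV mul1g.
by exists a => //; apply/pi_quotientP; rewrite mulgA mulVg mul1g.
Qed.

(** If [x^-1 * y] is outside the closed [N], this persists near [(x, y)]; since [pi] is open, the
    two cosets get disjoint neighbourhoods. *)
Lemma hausdorff_quotient_group : closed N -> hausdorff_space (quotient_group N).
Proof.
move=> cN p q; have [x <-] := pi_quotient_surj p.
have [y <-] := pi_quotient_surj q => clxy.
apply/pi_quotientP; apply: contrapT => nNxy.
have : nbhs (x, y) ((fun xy : G * G => xy.1^-1 * xy.2) @^-1` (~` N)).
  apply: (_ : (fun xy : G * G => xy.1^-1 * xy.2) @ nbhs (x, y) --> x^-1 * y).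
    by apply: cvg_mul; [apply: cvg_inv; exact: cvg_fst | exact: cvg_snd].
  by apply: open_nbhs_nbhs; split=> //; exact: closed_openC.
case=> -[A B] /= [nA nB] AB.
have pi_nbhs (z : G) (C : set G) : nbhs z C -> nbhs (pi z) (pi @` C).
  rewrite nbhsE => -[V [oV Vz] VC]; apply: (@filterS _ _ _ (pi @` V)).
    by move=> _ [w Vw <-]; exists w => //; exact: VC.
  by apply: open_nbhs_nbhs; split; [exact: pi_quotient_open | exists z].
have [_ [[a Aa <-] [b Bb /esym/pi_quotientP Nab]]] :=
  clxy _ _ (pi_nbhs x A nA) (pi_nbhs y B nB).
exact: (AB (a, b)).
Qed.

End QuotientTopology.

Section ImageSubgroup.
Context (G H : groupType) (f : G -> H) (fM : {morph f : x y / x * y}).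

Fact image_subgroup1 (K : subgroup G) : (f @` K) 1.
Proof. by exists 1; [exact: subgroup1 | exact: gmorph1]. Qed.

Fact image_subgroupF (K : subgroup G) x y :
  (f @` K) x -> (f @` K) y -> (f @` K) (x / y).
Proof.
move=> [a Ka <-] [b Kb <-]; exists (a / b); first exact: subgroupF.
by rewrite fM (gmorphV fM).
Qed.

Definition image_subgroup (K : subgroup G) : subgroup H :=
  Subgroup (@image_subgroup1 K) (@image_subgroupF K).

Lemma image_subgroupJ (A B : set G) :
  normalised_by B A -> normalised_by (f @` B) (f @` A).
Proof.
move=> nA _ _ [x Ax <-] [y By <-]; exists (x ^ y); first exact: nA.
exact: gmorphJ.
Qed.

End ImageSubgroup.

(* quasisimplicity of a closed subgroup [Q], read inside [G]: the types of [Q]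
   and [Q / Z(Q)] do not occur *)
Definition quasisimple_in (G : topGroupType) (Q : set G) : Prop :=
  [/\ Q `<=` generated (commutators Q), ~ Q `<=` centraliser Q &
      forall N : subgroup G, closed N -> N `<=` Q -> normalised_by Q N ->
        N `<=` centraliser Q \/ Q `<=` N].

Section Quasisimple.
Context (G : topGroupType) (cG : compact [set: G]) (hG : hausdorff_space G).
Context (Q : subgroup G) (cQ : closed Q).
Local Notation T := (subgroup_type Q).

Let valM : {morph (val : T -> G) : x y / x * y} := @val_subgroupM _ Q.

Let cT : compact [set: T]. Proof. exact: compact_subgroup_type. Qed.
Let hT : hausdorff_space T. Proof. exact: hausdorff_subgroup_type. Qed.

Lemma closed_val_image (A : set T) : closed A -> closed ((val : T -> G) @` A).
Proof.
move=> cA; apply: compact_closed => //; apply: continuous_compact.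
  by apply: continuous_subspaceT; exact: val_subgroup_continuous.
exact: subclosed_compact cA cT _.
Qed.

Lemma closed_val_preimage (A : set G) : closed A ->
  closed ((val : T -> G) @^-1` A).
Proof.
by apply: preimage_closed => t _; exact: val_subgroup_continuous.
Qed.

Lemma perfect_subgroupP : perfect T <-> Q `<=` generated (commutators Q).
Proof.
split=> [pT x /subgroup_typeP[t <-] H cH commH|pQ].
  have : generated [set z : T | exists x y, z = [~ x, y]] t by rewrite pT.
  apply: (@generated_min _ _ (preimage_subgroup valM H)).
    exact: closed_val_preimage.
  move=> _ [u [v ->]]; suff : subgroup_set H ((val : T -> G) [~ u, v]) by [].
  rewrite (gmorphR valM); apply: commH.
  by exists (val u), (val v); split=> //; exact: val_subgroupP.
apply/seteqP; split=> // t _ H cH commH.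
have [||u Hu /val_inj <- //] := pQ _ (val_subgroupP t) (image_subgroup valM H).
- exact: closed_val_image.
- move=> _ [x [y [/subgroup_typeP[u <-] /subgroup_typeP[v <-] ->]]].
  by exists [~ u, v]; [apply: commH; exists u, v | exact: gmorphR].
Qed.

Lemma center_subgroup_typeP (t : T) :
  center [set: T] t <-> centraliser Q (val t).
Proof.
split=> [[_ Ct] _ /subgroup_typeP[u <-]|Ct].
  by rewrite /commute -!valM (Ct u I).
split=> // u _; apply: val_inj; rewrite !valM; apply: Ct.
exact: val_subgroupP.
Qed.

Local Notation Z := (center_subgroup T).
Local Notation pi := (\pi_(quotient_group Z) : T -> quotient_group Z).

Let piM : {morph pi : x y / x * y} := @pi_quotientM _ Z.

Let closed_center : closed Z.
Proof.
rewrite (_ : subgroup_set Z = centraliser [set: T]).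
  exact: closed_centraliser.
by apply/seteqP; split=> [t []|t Ct].
Qed.

(** Closed normal subgroups are carried between [Q] and its central quotient by images and
    preimages; images stay closed by compactness. *)
Lemma quasisimple_inP : quasisimple (subgroup_type Q) <-> quasisimple_in Q.
Proof.
split=> [[pT [[q q1] simT]]|[pQ nabQ normQ]].
- split; first exact/perfect_subgroupP.
    move=> QQ; apply: q1; have [t <-] := pi_quotient_surj q.
    apply/pi_quotient1P/center_subgroup_typeP; apply: QQ.
    exact: val_subgroupP.
  move=> N cN NQ nN; pose N' := preimage_subgroup valM N.
  have cN' : closed N' by exact: closed_val_preimage.
  have nN' : normalised_by [set: T] N'.
    move=> t u Nt _; suff : subgroup_set N ((val : T -> G) (t ^ u)) by [].
    by rewrite (gmorphJ valM); apply: nN => //; exact: val_subgroupP.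
  have npiN : normalised_by [set: quotient_group Z] (image_subgroup piM N').
    move=> x y Nx _; have [t <-] := pi_quotient_surj y.
    by apply: (image_subgroupJ piM nN') => //; exists t.
  have [|piN|piN] := simT (NormalSubgroup npiN).
  + exact: closed_pi_image.
  + left=> x Nx; have [t tx] := subgroup_typeP (NQ x Nx); rewrite -tx.
    apply/center_subgroup_typeP; apply/(@pi_quotient1P _ Z).
    suff : subgroup_set (image_subgroup piM N') (pi t) by rewrite piN.
    by exists t => //; rewrite /= tx.
  (* Here [T = N' Z]. Central factors do not change commutators, so [N'] contains all commutators of
     [T], and [T] is perfect. *)
  + right=> x /subgroup_typeP[t <-].
    suff : subgroup_set N' t by []; have : [set: T] t by []; rewrite -pT; apply.
      exact: cN'.
    have ZN u : exists2 n, subgroup_set N' n & center [set: T] (n^-1 * u).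
      have : subgroup_set (image_subgroup piM N') (pi u) by rewrite piN.
      by case=> n Nn /pi_quotientP Znu; exists n.
    move=> _ [u [v ->]]; have [n Nn [_ Znu]] := ZN u.
    have [m Nm [_ Zmv]] := ZN v.
    have -> : [~ u, v] = [~ n, m].
      rewrite -[u](mulVKg n) -[v](mulVKg m) commg_mul_central //;
      by [exact: Znu | exact: Zmv].
    exact: subgroupR.
- split; first exact/perfect_subgroupP.
  split.
    apply: contrapT => triv; apply: nabQ => _ /subgroup_typeP[t <-].
    apply/center_subgroup_typeP; apply/(@pi_quotient1P _ Z).
    apply: contrapT => t1.
    by apply: triv; exists (pi t).
  move=> M cM; pose M' := preimage_normal piM M.
  have cM' : closed M'.
    by apply: preimage_closed => // t _; exact: continuous_pi_quotient.
  have [|||CM|QM] := normQ (image_subgroup valM M').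
  + exact: closed_val_image.
  + by move=> _ [t _ <-]; exact: val_subgroupP.
  + move=> _ _ [t Mt <-] /subgroup_typeP[u <-]; exists (t ^ u).
      exact: normalJ.
    exact: gmorphJ.
  + left; apply/seteqP; split=> [x Mx|_ ->]; last exact: subgroup1.
    have [t tx] := pi_quotient_surj x; rewrite -tx.
    apply/pi_quotient1P/center_subgroup_typeP; apply: CM.
    by exists t => //; rewrite /= tx.
  + right; apply/seteqP; split=> // x _; have [t <-] := pi_quotient_surj x.
    by have [u Mu /val_inj <-] := QM _ (val_subgroupP t).
Qed.

End Quasisimple.

(** * Components and normal subgroups *)

(** As [[N, Q]] centralises [Q], the three subgroup lemma makes [N] centralise the commutators of
    [Q], which generate a closed subgroup containing [Q]. *)
Lemma perfect_three_subgroups (G : topGroupType) (Q N : subgroup G) :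
  hausdorff_space G -> Q `<=` generated (commutators Q) ->
  (forall z x, subgroup_set N z -> subgroup_set Q x ->
     centraliser Q [~ z, x]) ->
  N `<=` centraliser Q.
Proof.
move=> hG pQ NQ z Nz x Qx.
apply: (centraliser_generated hG (A := commutators Q)).
  move=> _ [a [b [Qa Qb ->]]]; apply: commute_sym.
  rewrite -[b]invgK; apply: three_commutators; last first.
    by apply: NQ => //; [exact: subgroupV | exact: subgroupV].
  apply: commute_sym; rewrite -invgR; apply: commuteV; apply: commute_sym.
  by apply: NQ => //; exact: subgroupV.
exact: pQ.
Qed.

Lemma normal_component (G : topGroupType) (Q N : subgroup G) :
  hausdorff_space G -> quasisimple_in Q -> subnormal Q -> closed N ->
  normalised_by [set: G] N -> Q `<=` N \/ Q `<=` centraliser N.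
Proof.
move=> hG [pQ nabQ normQ] [n [c [c0 cn cS]]] cN nN.
suff [_ /(_ N)] : Q `<=` c n /\ forall N : subgroup G, closed N ->
    N `<=` c n -> normalised_by (c n) N -> Q `<=` N \/ N `<=` centraliser Q.
  rewrite cn => /(_ cN (@subsetT _ _) nN)[QN|NQ]; [by left|right].
  by move=> x Qx y Ny; apply: commute_sym; exact: NQ.
have : (n <= n)%N by [].
(* Induction along the chain from [Q] up to [c i]; the alternative is claimed for every closed
   normal subgroup of [c i]. *)
elim: {1 3 4 5}n => [_|i IH lin {cN nN N}].
  rewrite c0; split=> // M cM MQ nM.
  by case: (normQ M cM MQ nM) => [|]; [right | left].
have [Qci IHi] := IH (ltnW lin); have [cci cii nci] := cS i lin.
split=> [|N cN Nc nN]; first exact: subset_trans cii.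
have [|x [Nx cx] //|x y [Nx cx] cy|QN|NQ] := IHi (setI_subgroup N (c i)).
- exact: closedI.
- by split; [apply: nN => //; exact: cii | exact: subgroupJ].
- by left=> x /QN[].
(* The commutators of [N] with [Q] lie in [N], which [Q] normalises, and in [c i], which [N]
   normalises; this intersection centralises [Q]. *)
right; apply: perfect_three_subgroups => // z x Nz Qx; apply: NQ; split.
  rewrite commgEl; apply: subgroupM; first exact: subgroupV.
  by apply: nN => //; apply: cii; exact: Qci.
rewrite commgEr; apply: subgroupM; last exact: Qci.
by apply: nci; [apply: subgroupV; exact: Qci | exact: Nc].
Qed.

(** In each finite quotient the image of [Q] is a p-group equal to its derived subgroup, hence
    trivial. *)
Lemma perfect_p_elements_trivial (G : topGroupType) (Q : subgroup G) (p : nat) :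
  profinite G -> prime p -> Q `<=` generated (commutators Q) ->
  (forall x, subgroup_set Q x -> p_element p x) -> Q `<=` [set 1].
Proof.
move=> profG pp pQ Qp x Qx; have [cG hG _] := profG.
have c1 : closed [set (1 : G)].
  by apply: accessible_closed_set1; exact: hausdorff_accessible.
apply: ((closed_open_normalP _ profG).1 c1) => U oU.
exists 1 => //; rewrite invg1 mul1g.
have [gT [f [fM fU _ _]]] := finite_quotient_morphism cG oU.
pose A := image_group fM Q.
have pA : p.-group A.
  apply/pgroupP => q pq /(Cauchy pq)[_ /image_setP[y Qy <-] oy].
  have [k /fU] := Qp y Qy U oU; rewrite (gmorphX fM) => /(p_elt_expg pp).
  by rewrite /p_elt oy pnatE.
have sAA' : A \subset A^`(1).
  apply/fintype.subsetP => _ /image_setP[y Qy <-].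
  have D1 : f 1 \in A^`(1) by rewrite (gmorph1 fM) group1.
  have DF a b : f a \in A^`(1) -> f b \in A^`(1) -> f (a / b) \in A^`(1).
    by move=> Da Db; rewrite fM (gmorphV fM) groupM ?groupV.
  (* [D] is the preimage of the derived subgroup. It contains [U], so it is open and closed, and
     topological perfectness puts [Q] inside it. *)
  pose D := @Subgroup G [set g | f g \in A^`(1)] D1 DF.
  apply: (pQ y Qy D).
    apply: open_subgroup_closed; apply: open_subgroup.
    by apply: filterS (open_nbhs1 oU) => g /fU fg /=; rewrite fg group1.
  move=> _ [a [b [Qa Qb ->]]] /=; rewrite (gmorphR fM).
  by apply: mem_commg; apply/image_setP; [exists a | exists b].
have A1 : A :=: 1%g.
  apply/eqP; apply: contraT => ntA.
  have := sol_der1_proper (nilpotent_sol (pgroup_nil pA)) (fintype.subxx _) ntA.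
  by rewrite properE sAA' andbF.
have : f x \in (A : {set gT}) by apply/image_setP; exists x.
by rewrite A1 inE => /eqP/fU.
Qed.

(** A component lies in a given normal pro-p subgroup or centralises it. In the first case it would
    be perfect and made of p-elements, hence trivial, whereas a quasisimple group is not abelian. *)
Lemma Fitting_centralises_layer (G : topGroupType) : profinite G ->
  Fitting G `<=` centraliser (layer G).
Proof.
move=> profG; have [cG hG _] := profG.
have cL A : closed (centraliser_subgroup A : set G).
  exact: closed_centraliser.
apply: (@generated_min _ _ (centraliser_subgroup (layer G))) => //.
move=> x [p [pp]]; move: x.
apply: (@generated_min _ _ (centraliser_subgroup (layer G))) => //.
move=> x [N [cN pN Nx]].
apply: centraliser_generated => // y [Q [[cQ sQ qQ] Qy]].
have qQ' := (quasisimple_inP cG hG cQ).1 qQ.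
have [|QN|QN] := normal_component hG qQ' sQ cN; first exact: normalJ.
- case: qQ' => pQ nabQ _; case: nabQ => z Qz w Qw.
  have Q1 : Q `<=` [set 1].
    apply: (perfect_p_elements_trivial profG pp pQ) => v Qv.
    have [t <-] := subgroup_typeP (QN _ Qv).
    apply: p_element_morph; first by [].
      exact: val_subgroup_continuous.
    exact: pro_p_element.
  by rewrite (Q1 z Qz) (Q1 w Qw).
- by apply: commute_sym; exact: QN.
Qed.

(** * The generalised Fitting subgroup *)

Section ConjugateComponent.
Context (G : topGroupType) (profG : profinite G).

Let cG : compact [set: G]. Proof. by case: profG. Qed.
Let hG : hausdorff_space G. Proof. by case: profG. Qed.

(** The conjugate of [H] by [g], written as a preimage so that the subgroup laws and closedness come
    from those of preimages. *)
Definition conj_subgroup (H : subgroup G) (g : G) : subgroup G :=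
  preimage_subgroup (conjgM_morph g^-1) H.

Lemma conj_subgroupP (H : subgroup G) (g x : G) :
  subgroup_set (conj_subgroup H g) (x ^ g) <-> subgroup_set H x.
Proof. by rewrite /= conjgK. Qed.

Lemma closed_conj_subgroup (H : subgroup G) (g : G) :
  closed H -> closed (conj_subgroup H g).
Proof. by apply: preimage_closed => x _; exact: continuous_conj. Qed.

Lemma conj_subgroup_subset (H K : subgroup G) (g : G) :
  H `<=` K -> conj_subgroup H g `<=` conj_subgroup K g.
Proof. by move=> HK x; exact: HK. Qed.

Lemma conj_subgroup_normalised (H K : subgroup G) (g : G) :
  normalised_by K H -> normalised_by (conj_subgroup K g) (conj_subgroup H g).
Proof. by move=> nHK x y Hx Ky; rewrite /= conjJg; exact: nHK. Qed.

Lemma subnormal_conj (Q : subgroup G) (g : G) :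
  subnormal Q -> subnormal (conj_subgroup Q g).
Proof.
case=> n [c [c0 cn cS]]; exists n, (fun i => conj_subgroup (c i) g); split.
- by apply/seteqP; split=> x /=; rewrite c0.
- by apply/seteqP; split=> x //= _; rewrite cn.
- move=> i lin; have [cci sci nci] := cS i lin; split.
  + exact: closed_conj_subgroup.
  + exact: conj_subgroup_subset.
  + exact: conj_subgroup_normalised.
Qed.

Lemma conj_commutators_generated (A B : set G) (g : G) :
  (forall x, A x -> B (x ^ g)) -> forall x, generated (commutators A) x ->
  generated (commutators B) (x ^ g).
Proof.
move=> AB x gx.
apply: (gx (preimage_subgroup (conjgM_morph g)
  (generated_subgroup (commutators B)))).
  apply: preimage_closed; last exact: closed_generated.
  by move=> z _; exact: continuous_conj.
move=> _ [a [b [Aa Ab ->]]]; apply: sub_generated.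
by exists (a ^ g), (b ^ g); split; [exact: AB | exact: AB | exact: conjRg].
Qed.

Lemma quasisimple_in_conj (Q : subgroup G) (g : G) :
  quasisimple_in Q -> quasisimple_in (conj_subgroup Q g).
Proof.
case=> pQ nabQ normQ; split.
- move=> x /= Qx; rewrite -[x](conjgKV g).
  apply: conj_commutators_generated (pQ _ Qx) => y Qy.
  exact/conj_subgroupP.
- move=> QQ; apply: nabQ => x Qx y Qy; apply: (@conjg_inj _ g).
  by rewrite /= conjMg (conjMg y); apply: QQ; apply/conj_subgroupP.
- move=> N cN NQ nN.
  have [|||NC|QN] := normQ (conj_subgroup N g^-1).
  + exact: closed_conj_subgroup.
  + move=> x /= Nx; apply/(@conj_subgroupP _ g); apply: NQ.
    by rewrite invgK in Nx.
  + move=> x y /= Nx Qy; rewrite invgK conjJg in Nx *; apply: nN => //.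
    exact/conj_subgroupP.
  + left=> x Nx y Qy; apply: (@conjg_inj _ g^-1).
    rewrite /= conjMg (conjMg y); apply: NC => //=.
    by rewrite invgK conjgKV.
  + right=> x Qx; have := QN _ Qx.
    by rewrite /= invgK conjgKV.
Qed.

Lemma layerJ : normalised_by [set: G] (layer G).
Proof.
apply: generatedJ => x g [Q [[cQ sQ qQ] Qx]] _; exists (conj_subgroup Q g).
split; last exact/conj_subgroupP.
have cQg := closed_conj_subgroup (g := g) cQ.
split=> //; first exact: subnormal_conj.
apply/(quasisimple_inP cG hG cQg)/quasisimple_in_conj.
exact/(quasisimple_inP cG hG cQ).
Qed.

Lemma FittingJ : normalised_by [set: G] (Fitting G).
Proof.
apply: generatedJ => x g [p [pp px]] _; exists p; split=> //.
move: x g px (I : [set: G] g); apply: generatedJ => x g [N [cN pN Nx]] _.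
by exists N; split=> //; exact: normalJ.
Qed.

Lemma generalised_FittingJ : normalised_by [set: G] (generalised_Fitting G).
Proof.
apply: generatedJ => x g [Fx|Ex] _; first by left; exact: FittingJ.
by right; exact: layerJ.
Qed.

End ConjugateComponent.

(** * The centraliser of [C] modulo [Z], and subnormal preimages *)

Section CentraliserMod.
Context (G : groupType) (C Z : normal_subgroup G).

(* the preimage in [G] of the centraliser of [C Z / Z] in [G / Z] *)
Definition centraliser_mod_set : set G :=
  [set g | forall c, subgroup_set C c -> subgroup_set Z [~ g, c]].

Fact centraliser_mod1 : centraliser_mod_set 1.
Proof. by move=> c _; rewrite comm1g; exact: subgroup1. Qed.

Fact centraliser_modF x y :
  centraliser_mod_set x -> centraliser_mod_set y -> centraliser_mod_set (x / y).
Proof.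
move=> Zx Zy c Cc; have -> : [~ x / y, c] = ([~ x, c] / [~ y, c]) ^ y^-1.
  by rewrite !commgEl !conjgE !invgM !invgK !mulgA !(mulgK, mulgVK).
by apply: normalJ => //; apply: subgroupF; [exact: Zx | exact: Zy].
Qed.

Fact centraliser_modJ : normalised_by [set: G] centraliser_mod_set.
Proof.
move=> x y Zx _ c Cc; rewrite -[c](conjgKV y) -conjRg.
by apply: normalJ => //; apply: Zx; exact: normalJ.
Qed.

Definition centraliser_mod : normal_subgroup G :=
  @NormalSubgroup G (Subgroup centraliser_mod1 centraliser_modF)
    centraliser_modJ.

End CentraliserMod.

Lemma closed_centraliser_mod (G : topGroupType) (C Z : normal_subgroup G) :
  closed Z -> closed (centraliser_mod C Z).
Proof.
move=> cZ; rewrite (_ : subgroup_set (centraliser_mod C Z) =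
  \bigcap_(c in subgroup_set C) ((fun g => [~ g, c]) @^-1` Z)).
  apply: closed_bigI => c _; apply: preimage_closed => // x _.
  exact: continuous_comm.
by apply/seteqP; split=> g Zg c Cc; exact: Zg.
Qed.

Lemma subnormal_step (G : topGroupType) (Q H : subgroup G) :
  subnormal H -> closed Q -> Q `<=` H -> normalised_by H Q -> subnormal Q.
Proof.
case=> n [c [c0 cn cS]] cQ QH nQ.
exists n.+1, (fun i => if i is j.+1 then c j else Q); split=> //.
case=> [|i] lin; last exact: cS.
by split; rewrite // c0.
Qed.

Lemma subnormal_preimageI (G H : topGroupType) (f : G -> H)
    (fM : {morph f : x y / x * y}) (Q : subgroup H) (C : normal_subgroup G) :
  continuous f -> closed C -> subnormal Q ->
  subnormal (setI_subgroup (preimage_subgroup fM Q) C).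
Proof.
move=> fC cC [n [c [c0 cn cS]]].
pose P i := setI_subgroup (preimage_subgroup fM (c i)) C.
(* The chain is pulled back and cut with [C], which takes it from [Q] up to [C]; one more term, the
   centraliser of the empty set, is all of [G]. *)
exists n.+1, (fun i => if (i <= n)%N then P i else centraliser_subgroup set0).
split.
- by apply/seteqP; split=> x /=; rewrite c0.
- by rewrite ltnn; apply/seteqP; split=> // x _ y [].
move=> i; rewrite ltnS => lin; rewrite lin; case: (ltnP i n) => [ltin|lein].
  have [cci cii nci] := cS i ltin; split.
  - by apply: closedI => //; apply: preimage_closed => // x _; exact: fC.
  - by move=> x [cx Cx]; split=> //; exact: cii.
  - move=> x y [cx Cx] [cy _]; split; last exact: normalJ.
    by rewrite /= (gmorphJ fM); exact: nci.
have {lein lin} -> : i = n by apply/eqP; rewrite eqn_leq lin.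
have -> : (P n : set G) = C.
  by apply/seteqP; split=> [x []|x Cx] //=; rewrite cn.
by split=> // [x _ y []//|x y Cx _]; exact: normalJ.
Qed.

Fact trivial_subgroupF (G : groupType) (x y : G) :
  [set 1] x -> [set 1] y -> [set (1 : G)] (x / y).
Proof. by move=> -> ->; rewrite /= mulgV. Qed.

Definition trivial_subgroup (G : groupType) : subgroup G :=
  @Subgroup G [set 1] erefl (@trivial_subgroupF G).

Lemma Fitting_degenerateI (G : topGroupType) : hausdorff_space G ->
  (forall p (N : normal_subgroup G), prime p -> closed N ->
     pro_p p (subgroup_type N) -> N `<=` [set 1]) ->
  (forall Q : subgroup G, ~ component Q) ->
  Fitting_degenerate G.
Proof.
move=> hG noN noQ; have c1 : closed (trivial_subgroup G : set G).
  by apply: accessible_closed_set1; exact: hausdorff_accessible.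
apply/seteqP; split=> [|_ ->]; last exact: generated1.
apply: (@generated_min _ _ (trivial_subgroup G)) => // x [].
  move: x; apply: (@generated_min _ _ (trivial_subgroup G)) => // x [p [pp]].
  move: x; apply: (@generated_min _ _ (trivial_subgroup G)) => // x [N [cN pN]].
  exact: noN pN x.
move: x; apply: (@generated_min _ _ (trivial_subgroup G)) => // x [Q [qQ _]].
by case: (noQ Q).
Qed.

(** * Fitting-degeneracy of the quotient by [K] *)

Section CentraliserModQuotient.
Context (G : topGroupType) (profG : profinite G).
Context (C Z : normal_subgroup G) (closedC : closed C) (closedZ : closed Z).
Context (ZC : Z `<=` C).
Context (Z_central : forall z c, subgroup_set Z z -> subgroup_set C c ->
  commute z c).
Context (pronilpotent_sub_Z : forall N : normal_subgroup G,
  closed N -> N `<=` C -> pronilpotent N -> N `<=` Z).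
Context (no_component_in_C : forall Q : subgroup G, component Q ->
  ~ Q `<=` C).

Local Notation K := (centraliser_mod C Z).
Local Notation pi := (\pi_(quotient_group K) : G -> quotient_group K).

Let cG : compact [set: G]. Proof. by case: profG. Qed.
Let hG : hausdorff_space G. Proof. by case: profG. Qed.
Let piM : {morph pi : x y / x * y} := @pi_quotientM _ K.
Let pi_cont : continuous pi := @continuous_pi_quotient _ K.
Let closedK : closed K. Proof. exact: closed_centraliser_mod. Qed.
Let hQ : hausdorff_space (quotient_group K).
Proof. exact: hausdorff_quotient_group. Qed.

(* [K n C] has class at most 2. *)
Lemma centraliser_modI x :
  subgroup_set K x -> subgroup_set C x -> subgroup_set Z x.
Proof.
move=> Kx Cx; apply: (@pronilpotent_sub_Z (setI_normal K C)) => //.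
- exact: closedI.
- by move=> y [].
- apply: class2_pronilpotent => // a b c [Ka _] [_ Cb] [_ Cc].
  by apply: Z_central => //; exact: Ka.
Qed.

(** The image of [C] has trivial centraliser: if [pi g] centralises it, each [[~ g, c]] lies in [K]
    and [C], hence in [Z], which means that [g] is in [K]. *)
Lemma centralises_pi1 g :
  (forall c, subgroup_set C c -> commute (pi g) (pi c)) -> pi g = 1.
Proof.
move=> gC; apply/(@pi_quotient1P _ K) => c Cc; apply: centraliser_modI.
  apply/(@pi_quotient1P _ K); rewrite (gmorphR piM).
  by apply/eqP/commgP; exact: gC.
rewrite commgEr; apply: subgroupM => //; apply: normalJ => //.
exact: subgroupV.
Qed.

Lemma pro_p_centraliser_mod_quotient p
    (N : normal_subgroup (quotient_group K)) :
  prime p -> closed N -> pro_p p (subgroup_type N) -> N `<=` [set 1].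
Proof.
move=> pp cN pN; pose M := preimage_normal piM N.
have cM : closed M by apply: preimage_closed => // x _; exact: pi_cont.
(* For [q] other than [p], a q-element of [M] in [C] maps to a q-element of the pro-p group [N],
   hence to 1; so it lies in [Z] and is central. *)
have MCZ : setI_normal M C `<=` Z.
  apply: pronilpotent_sub_Z; [exact: closedI | by move=> x [] |].
  apply: (@p'_central_pronilpotent _ profG _ p); first exact: closedI.
  move=> q x pq nqp [Mx Cx] qx z [_ Cz]; apply: Z_central => //.
  apply: centraliser_modI => //; apply/(@pi_quotient1P _ K).
  have [t tx] := subgroup_typeP (Mx : subgroup_set N (pi x)); rewrite -tx.
  have profT : profinite (subgroup_type N) by case: pN.
  suff -> : t = 1 by [].
  apply: (@p_q_element1 _ p q t profT pp pq).
  - by rewrite eq_sym.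
  - exact: pro_p_element.
  - exact: (p_element_subgroup_type profG piM pi_cont tx qx).
move=> q; have [g <-] := pi_quotient_surj q => Ng.
apply: centralises_pi1 => c Cc; apply/commgP; apply/eqP.
rewrite -(gmorphR piM); apply/(@pi_quotient1P _ K) => d Cd.
(* Normality of [M] and [C] puts the commutator in both; being in [Z], it centralises [C] and so
   vanishes under [pi]. *)
have Zgc : subgroup_set Z [~ g, c].
  apply: MCZ; split.
    rewrite commgEl; apply: subgroupM; first exact: (@subgroupV _ M).
    exact: (normalJ (n := M)).
  rewrite commgEr; apply: subgroupM => //; apply: normalJ => //.
  exact: subgroupV.
suff -> : [~ [~ g, c], d] = 1 by exact: subgroup1.
by apply/eqP/commgP; exact: Z_central.
Qed.

Lemma component_centraliser_mod_quotient (L : subgroup (quotient_group K)) :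
  ~ component L.
Proof.
case=> cL sL qL.
have cQ : compact [set: quotient_group K].
  have <- : pi @` [set: G] = [set: quotient_group K].
    apply/seteqP; split=> // x _.
    by have [y <-] := pi_quotient_surj x; exists y.
  by apply: continuous_compact => //; apply: continuous_subspaceT.
have /(quasisimple_inP cQ hQ cL)[pL nabL normL] := qL.
have normC : normalised_by [set: quotient_group K] (image_subgroup piM C).
  move=> x y Cx _; have [z <-] := pi_quotient_surj y.
  by apply: (image_subgroupJ piM (@normalJ _ C)) => //; exists z.
have [|LC|LC] := normal_component hQ (And3 pL nabL normL) sL _ normC.
- exact: closed_pi_image.
(* Case of [L] inside the image of [C]: the closed derived subgroup [P] of [M] will be a component
   of [G] inside [C], which is excluded. *)
- pose M := setI_subgroup (preimage_subgroup piM L) C.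
  have cM : closed M.
    by apply: closedI => //; apply: preimage_closed => // x _; exact: pi_cont.
  pose P := generated_subgroup (commutators M).
  have PM : P `<=` M.
    apply: generated_min => // _ [x [y [Mx My ->]]].
    exact: (@subgroupR _ M).
  have PC x : subgroup_set P x -> subgroup_set C x by move=> /PM[].
  have cP : closed P := @closed_generated _ _.
  have LP : L `<=` pi @` P.
    apply: subset_trans pL _.
    apply: (@generated_min _ _ (image_subgroup piM P)).
      exact: closed_pi_image.
    move=> _ [a [b [La Lb ->]]].
    have [x Cx xa] := LC a La; have [y Cy yb] := LC b Lb.
    exists [~ x, y]; last by rewrite (gmorphR piM) xa yb.
    apply: sub_generated; exists x, y.
    by split=> //; split=> //=; rewrite ?xa ?yb.
  (* A subgroup of [C] covering [L] covers [M] up to factors in [K] and [C], that is, in [Z]. As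
     these are central in [C], it has all the commutators of [M]; this serves for [P] itself and for
     its normal subgroups. *)
  have decomp (N : subgroup G) x : N `<=` C -> L `<=` pi @` N ->
      subgroup_set M x ->
      exists a z, [/\ subgroup_set N a, subgroup_set Z z & x = a * z].
    move=> NC LN [Lx Cx]; have [a Na /pi_quotientP Kax] := LN _ Lx.
    exists a, (a^-1 * x); split=> //; last by rewrite mulVKg.
    apply: centraliser_modI => //; apply: subgroupM => //.
    by apply: subgroupV; exact: NC.
  have commE (N : subgroup G) : N `<=` C -> L `<=` pi @` N ->
      commutators M `<=` commutators N.
    move=> NC LN _ [x [y [Mx My ->]]].
    have [a [z [Na Zz ->]]] := decomp N x NC LN Mx.
    have [b [w [Nb Zw ->]]] := decomp N y NC LN My.
    exists a, b; split=> //; rewrite commg_mul_central //;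
    apply: Z_central => //; by [exact: NC | exact: ZC].
  have pP : P `<=` generated (commutators P).
    apply: (generated_min (H := generated_subgroup (commutators P))).
      exact: closed_generated.
    by move=> z /(commE P PC LP); exact: sub_generated.
  have nabP : ~ P `<=` centraliser P.
    move=> PP; apply: nabL => _ /LP[x Px <-] _ /LP[y Py <-].
    by rewrite /commute -!piM (PP x Px y Py).
  apply: (no_component_in_C _ PC); split=> //.
    apply: (@subnormal_step _ P M) => //; first exact: subnormal_preimageI.
    apply: generatedJ => _ g [x [y [Mx My ->]]] Mg; rewrite conjRg.
    by exists (x ^ g), (y ^ g); split=> //; exact: subgroupJ.
  apply/(quasisimple_inP cG hG cP); split=> //.
  move=> N cN NP nN; have NC : N `<=` C by move=> x /NP/PC.
  have [|||NL|LN] := normL (image_subgroup piM N).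
  + exact: closed_pi_image.
  + by move=> _ [x Nx <-]; have [] := PM _ (NP x Nx).
  + move=> x y Nx /LP Py; exact: (image_subgroupJ piM nN).
  (* The image of [N] is central in [L], so [[N, P]] lies in [K] and [C], hence in [Z], and
     centralises [P]. *)
  + left; apply: perfect_three_subgroups => // x y Nx Py z Pz.
    apply: Z_central; last exact: PC.
    apply: centraliser_modI; last first.
      by apply: subgroupR; [exact: NC | exact: PC].
    apply/(@pi_quotient1P _ K); rewrite (gmorphR piM); apply/eqP/commgP.
    apply: NL; first by exists x.
    by have [] := PM _ Py.
  + right; apply: (generated_min (H := N)) => // z /(commE N NC LN).
    by case=> x [y [Nx Ny ->]]; exact: subgroupR.
(* Case of [L] centralising the image of [C]: then [L] is trivial, hence abelian. *)
- apply: nabL => q Lq r Lr; have [g gq] := pi_quotient_surj q.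
  suff -> : q = 1 by apply: commute_sym; exact: commute1.
  rewrite -gq; apply: centralises_pi1 => c Cc.
  by rewrite gq; apply: LC => //; exists c.
Qed.

Lemma degenerate_centraliser_mod_quotient :
  Fitting_degenerate (quotient_group K).
Proof.
apply: Fitting_degenerateI => //; first exact: pro_p_centraliser_mod_quotient.
exact: component_centraliser_mod_quotient.
Qed.

End CentraliserModQuotient.

(** * The centraliser of the generalised Fitting subgroup *)

Theorem theoremB (G : topGroupType) (profG : profinite G)
    (regG : Fitting_regular G) :
  centraliser (generalised_Fitting G) = center (Fitting G).
Proof.
have [cG hG _] := profG.
have FsubF x : Fitting G x -> generalised_Fitting G x.
  by move=> Fx; apply: sub_generated; left.
apply/seteqP; split=> [x Cx|x [Fx CFx]]; last first.
  apply: centraliser_generated => // y [Fy|Ey]; first exact: CFx.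
  exact: (Fitting_centralises_layer profG).
pose C := @NormalSubgroup G (centraliser_subgroup (generalised_Fitting G))
  (centraliserJ (generalised_FittingJ profG)).
pose F := @NormalSubgroup G
  (generated_subgroup [set x | exists p : nat, prime p /\ p_core p G x])
  (@FittingJ G).
pose Z := setI_normal C F.
have cC : closed C by exact: closed_centraliser.
have cZ : closed Z by apply: closedI => //; exact: closed_generated.
have ZC : Z `<=` C by move=> y [].
have Z_central z c : subgroup_set Z z -> subgroup_set C c -> commute z c.
  by move=> [_ Fz] Cc; apply: commute_sym; apply: Cc; exact: FsubF.
have nilZ (N : normal_subgroup G) :
    closed N -> N `<=` C -> pronilpotent N -> N `<=` Z.
  move=> cN NC nilN y Ny; split; first exact: NC.
  exact: (pronilpotent_Fitting profG cN nilN).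
have noE (Q : subgroup G) : component Q -> ~ Q `<=` C.
  (* A component inside [C] commutes with the layer, hence with itself, but a quasisimple group is
     not abelian. *)
  move=> qQ QC; have [cQ _ /(quasisimple_inP cG hG cQ)[_ nabQ _]] := qQ.
  apply: nabQ => y Qy z Qz; apply: (QC y Qy); apply: sub_generated; right.
  by apply: sub_generated; exists Q.
have degK := degenerate_centraliser_mod_quotient profG cC cZ ZC Z_central
  nilZ noE.
split; last by move=> y Fy; apply: Cx; exact: FsubF.
(* [x] is in [C], so it is enough to place it in [K]; otherwise the quotient by [K] would be
   nontrivial and degenerate, against regularity. *)
suff [] : subgroup_set Z x by [].
apply: (centraliser_modI profG cC cZ Z_central nilZ) => //.
apply: contrapT => nKx.
apply: (regG (centraliser_mod C Z)) degK; first exact: closed_centraliser_mod.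
by exists (\pi_(quotient_group (centraliser_mod C Z)) x) => /pi_quotient1P.
Qed.
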